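(* Let $d\geqslant 1$. Given a finite group $G$ and a subgroup $P$ of the $d$-dimensional hyperoctahedral group $W_d$, there is an aperiodic, primitive, bijective $d$-dimensional (rectangular) substitution $\varrho$ whose shift space $\mathbb{X}_\varrho$ satisfies $$\mathcal{S}(\mathbb{X}_\varrho)\simeq\mathbb{Z}^d\times G,\qquad \mathcal{R}(\mathbb{X}_\varrho)\simeq(\mathbb{Z}^d\rtimes P)\times G,$$ where $P\leqslant W_d\leqslant\mathrm{GL}(d,\mathbb{Z})$ acts on $\mathbb{Z}^d$ in the natural way.
   Context: $W_d\leqslant\mathrm{GL}(d,\mathbb{Z})$ is the hyperoctahedral group of all $d\times d$ signed permutation matrices. Let $\mathcal{A}$ be a finite alphabet and $R=\prod_{i=1}^d[0,L_i-1]\subset\mathbb{Z}^d$ with $L_i\geqslant 2$. A $d$-dimensional rectangular substitution is a map $\varrho\colon\mathcal{A}\to\mathcal{A}^R$, extended to patterns $P$ on finite subsets of $\mathbb{Z}^d$ by $\varrho(P)_{Q\boldsymbol{n}+\boldsymbol{r}}=\varrho(P_{\boldsymbol{n}})_{\boldsymbol{r}}$ for $\boldsymbol{r}\in R$, with $Q=\mathrm{diag}(L_1,\dots,L_d)$. It is primitive if for some $k\geqslant1$ every $\varrho^k(a)$, $a\in\mathcal{A}$, contains every letter. It is bijective if for every $\boldsymbol{i}\in R$ the column $a\mapsto\varrho(a)_{\boldsymbol{i}}$ is a bijection of $\mathcal{A}$. The shift space (hull) $\mathbb{X}_\varrho\subseteq\mathcal{A}^{\mathbb{Z}^d}$ is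 the set of all $x\in\mathcal{A}^{\mathbb{Z}^d}$ all of whose finite patterns occur (up to translation) in some $\varrho^k(a)$; it carries the product topology and the shift action $(\sigma_{\boldsymbol{n}}(x))_{\boldsymbol{m}}=x_{\boldsymbol{n}+\boldsymbol{m}}$ of $\mathbb{Z}^d$. It (and $\varrho$) is aperiodic if no $x\in\mathbb{X}_\varrho$ satisfies $\sigma_{\boldsymbol{n}}(x)=x$ for some $\boldsymbol{n}\neq\boldsymbol{0}$. The symmetry group $\mathcal{S}(\mathbb{X}_\varrho)$ and the extended symmetry group $\mathcal{R}(\mathbb{X}_\varrho)$ are, respectively, the centraliser and the normaliser of $\mathcal{G}=\{\sigma_{\boldsymbol{n}}:\boldsymbol{n}\in\mathbb{Z}^d\}$ in the group of all self-homeomorphisms of $\mathbb{X}_\varrho$. *)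

(* Defs.v *)
(* MathComp with MathComp-Analysis. Vectors of Z^d are integer columns. *)
From HB Require Import structures.
From mathcomp Require Import all_boot all_order all_fingroup all_algebra.
From mathcomp Require Import all_classical all_reals all_analysis.

Set Implicit Arguments.
Unset Strict Implicit.
Unset Printing Implicit Defensive.

Import Order.TTheory GRing.Theory Num.Theory.

Local Open Scope classical_set_scope.
Local Open Scope ring_scope.

Notation "''Zd_' d" := ('cV[int]_d)
  (at level 8, d at level 2, format "''Zd_' d") : type_scope.

(** A signed permutation matrix becomes a permutation matrix once the signs of
    its entries are dropped. *)
Definition is_signed_perm_mx d (M : 'M[int]_d) : bool :=
  is_perm_mx (map_mx (fun z : int => `|z|) M).

Record hyperoct d := Hyperoct {
  hyperoct_mx :> 'M[int]_d;
  hyperoctP : is_signed_perm_mx hyperoct_mx }.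

HB.instance Definition _ d := [isSub for @hyperoct_mx d].
HB.instance Definition _ d := [Countable of hyperoct d by <:].

Lemma is_signed_perm_mxP d (M : 'M[int]_d) :
  reflect (exists (s : 'S_d) (e : {ffun 'I_d -> bool}),
             M = \matrix_(i, j) ((-1) ^+ e i *+ (s i == j)))
          (is_signed_perm_mx M).
Proof.
apply: (iffP (is_perm_mxP _)) => [[s Ms]|[s [e ->]]]; last first.
  exists s; apply/matrixP => i j; rewrite !mxE.
  by case: (s i == j); rewrite ?mulr1n ?mulr0n ?normr0 // normrX normrN1 expr1n.
exists s, [ffun i => M i (s i) < 0]; apply/matrixP => i j.
have := (matrixP _ _).2 Ms i j; rewrite !mxE ffunE.
case: eqP => [<-|_] /=; last by move/eqP; rewrite normr_eq0 => /eqP.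
move=> Mij; rewrite mulr1n; case: ltP => M0.
  by rewrite expr1 -[LHS]opprK -(ltr0_norm M0) Mij.
by rewrite expr0 -(ger0_norm M0) Mij.
Qed.

Definition hyperoct_enum d : seq 'M[int]_d :=
  [seq \matrix_(i, j) ((-1) ^+ (p.2 : {ffun 'I_d -> bool}) i
                        *+ ((p.1 : 'S_d) i == j))
  | p : 'S_d * {ffun 'I_d -> bool}].

Lemma hyperoct_finite d :
  Finite.axiom (undup (pmap insub (hyperoct_enum d) : seq (hyperoct d))).
Proof.
apply: Finite.uniq_enumP => [|M]; first exact: undup_uniq.
rewrite mem_undup mem_pmap_sub.
have /is_signed_perm_mxP[s [e Me]] := valP M.
by apply/mapP; exists (s, e); rewrite ?mem_enum.
Qed.

HB.instance Definition _ d :=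
  fintype.isFinite.Build (hyperoct d) (@hyperoct_finite d).

Lemma is_signed_perm_mx1 d : is_signed_perm_mx (1%:M : 'M[int]_d).
Proof.
rewrite /is_signed_perm_mx.
suff -> : map_mx (fun z : int => `|z|) 1%:M = 1%:M :> 'M[int]_d.
  exact: is_perm_mx1.
by apply/matrixP=> i j; rewrite !mxE; case: (i == j).
Qed.

Lemma is_signed_perm_mxM d (M N : 'M[int]_d) :
  is_signed_perm_mx M -> is_signed_perm_mx N -> is_signed_perm_mx (M *m N).
Proof.
move=> /is_signed_perm_mxP[s [e ->]] /is_signed_perm_mxP[t [f ->]].
apply/is_signed_perm_mxP; exists (s * t)%g, [ffun i => e i (+) f (s i)].
apply/matrixP => i j; rewrite !mxE (bigD1 (s i)) //= big1 => [|k /negPf ki].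
  rewrite !mxE eqxx mulr1n addr0 permM ffunE signr_addb.
  by case: (_ == j); rewrite ?mulr0n ?mulr0.
by rewrite !mxE eq_sym ki mulr0n mul0r.
Qed.

Lemma is_signed_perm_mx_tr d (M : 'M[int]_d) :
  is_signed_perm_mx M -> is_signed_perm_mx M^T.
Proof. by rewrite /is_signed_perm_mx -map_trmx is_perm_mx_tr. Qed.

Definition hyperoct1 d : hyperoct d := Hyperoct (is_signed_perm_mx1 d).
Definition hyperoctM d (M N : hyperoct d) : hyperoct d :=
  Hyperoct (is_signed_perm_mxM (valP M) (valP N)).
Definition hyperoctV d (M : hyperoct d) : hyperoct d :=
  Hyperoct (is_signed_perm_mx_tr (valP M)).

Lemma hyperoctMA d : associative (@hyperoctM d).
Proof. by move=> M N K; apply/val_inj; rewrite /= mulmxA. Qed.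
Lemma hyperoct1M d : left_id (@hyperoct1 d) (@hyperoctM d).
Proof. by move=> M; apply/val_inj; rewrite /= mul1mx. Qed.
Lemma hyperoctVM d : left_inverse (@hyperoct1 d) (@hyperoctV d) (@hyperoctM d).
Proof.
move=> M; apply/val_inj => /=.
have /is_signed_perm_mxP[s [e ->]] := valP M.
apply/matrixP => i j; rewrite !mxE (bigD1 (s^-1%g i)) //= big1 => [|k ki].
  rewrite !mxE permKV eqxx mulr1n addr0.
  case: (i == j); rewrite ?mulr0n ?mulr0 // mulr1n.
  by rewrite -signr_addb addbb.
rewrite !mxE; case: eqP => [si|_]; last by rewrite mulr0n mul0r.
by rewrite -si permK eqxx in ki.
Qed.

HB.instance Definition _ d := Finite_isGroup.Build (hyperoct d)
  (@hyperoctMA d) (@hyperoct1M d) (@hyperoctVM d).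

(** The pair [(n, g)] stands for the affine map [v |-> n + g v]. *)
Definition lattice_sdprod d (P : {group hyperoct d}) : Type :=
  ('Zd_d * subg_of P)%type.

Section LatticeSemidirect.
Variables (d : nat) (P : {group hyperoct d}).

Definition sdmx (g : subg_of P) : 'M[int]_d := hyperoct_mx (sgval g).

Definition sd_one : lattice_sdprod P := (0, 1%g).
Definition sd_mul (x y : lattice_sdprod P) : lattice_sdprod P :=
  (x.1 + sdmx x.2 *m y.1, (x.2 * y.2)%g).
Definition sd_inv (x : lattice_sdprod P) : lattice_sdprod P :=
  (- (sdmx x.2^-1%g *m x.1), x.2^-1%g).

Lemma sdmxM g h : sdmx (g * h)%g = sdmx g *m sdmx h.
Proof. by []. Qed.
Lemma sdmx1 : sdmx 1%g = 1%:M.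
Proof. by []. Qed.

Lemma sd_mulA : associative sd_mul.
Proof.
by move=> x y z; rewrite /sd_mul /= mulgA sdmxM mulmxDr mulmxA addrA.
Qed.
Lemma sd_mul1 : left_id sd_one sd_mul.
Proof. by case=> n g; rewrite /sd_mul /= sdmx1 mul1mx add0r mul1g. Qed.
Lemma sd_mulr1 : right_id sd_one sd_mul.
Proof. by case=> n g; rewrite /sd_mul /= mulmx0 addr0 mulg1. Qed.
Lemma sd_mulV : left_inverse sd_one sd_inv sd_mul.
Proof. by case=> n g; rewrite /sd_mul /= addNr mulVg. Qed.
Lemma sd_mulrV : right_inverse sd_one sd_inv sd_mul.
Proof.
case=> n g; rewrite /sd_mul /= mulmxN mulmxA -sdmxM mulgV sdmx1 mul1mx.
by rewrite addrN.
Qed.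

HB.instance Definition _ := Choice.on (lattice_sdprod P).
HB.instance Definition _ := isGroup.Build (lattice_sdprod P)
  sd_mulA sd_mul1 sd_mulr1 sd_mulV sd_mulrV.

End LatticeSemidirect.

Record selfhomeo (T : topologicalType) := SelfHomeo {
  homeo_fun :> T -> T;
  homeo_inv : T -> T;
  homeoK : cancel homeo_fun homeo_inv;
  homeoVK : cancel homeo_inv homeo_fun;
  homeo_continuous : continuous homeo_fun;
  homeo_inv_continuous : continuous homeo_inv }.

Section SelfHomeoGroup.
Variable T : topologicalType.
Implicit Types f g h : selfhomeo T.

Lemma selfhomeo_eq f g : f =1 g -> f = g.
Proof.
case: f g => [f f' fK f'K fc f'c] [g g' gK g'K gc g'c] /= /funext fg.
subst g; have /funext fg' : f' =1 g' by move=> x; rewrite -{1}(g'K x) fK.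
by subst g'; congr SelfHomeo; exact: Prop_irrelevance.
Qed.

Definition homeo1 : selfhomeo T :=
  @SelfHomeo T id id (fun=> erefl) (fun=> erefl) (fun x => @cvg_id _ (nbhs x))
    (fun x => @cvg_id _ (nbhs x)).

Lemma continuous_compT (f g : T -> T) :
  continuous f -> continuous g -> continuous (f \o g).
Proof. by move=> fc gc x; apply: continuous_comp; [exact: gc|exact: fc]. Qed.

Definition homeoM f g : selfhomeo T :=
  @SelfHomeo T (f \o g) (homeo_inv g \o homeo_inv f)
    (can_comp (@homeoK _ f) (@homeoK _ g))
    (can_comp (@homeoVK _ g) (@homeoVK _ f))
    (continuous_compT (@homeo_continuous _ f) (@homeo_continuous _ g))
    (continuous_compT (@homeo_inv_continuous _ g) (@homeo_inv_continuous _ f)).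

Definition homeoV f : selfhomeo T :=
  @SelfHomeo T (homeo_inv f) f (@homeoVK _ f) (@homeoK _ f)
    (@homeo_inv_continuous _ f) (@homeo_continuous _ f).

Lemma homeoMA : associative homeoM.
Proof. by move=> f g h; exact: selfhomeo_eq. Qed.
Lemma homeo1M : left_id homeo1 homeoM.
Proof. by move=> f; exact: selfhomeo_eq. Qed.
Lemma homeoM1 : right_id homeo1 homeoM.
Proof. by move=> f; exact: selfhomeo_eq. Qed.
Lemma homeoVM : left_inverse homeo1 homeoV homeoM.
Proof. by move=> f; apply: selfhomeo_eq => x; exact: homeoK. Qed.
Lemma homeoMV : right_inverse homeo1 homeoV homeoM.
Proof. by move=> f; apply: selfhomeo_eq => x; exact: homeoVK. Qed.

HB.instance Definition _ := gen_eqMixin (selfhomeo T).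
HB.instance Definition _ := gen_choiceMixin (selfhomeo T).
HB.instance Definition _ := isGroup.Build (selfhomeo T)
  homeoMA homeo1M homeoM1 homeoVM homeoMV.

End SelfHomeoGroup.

Definition centraliser (G : groupType) (S : set G) : set G :=
  [set x | forall y, S y -> commute x y].

Definition normaliser (G : groupType) (S : set G) : set G :=
  [set x | [set (y ^ x)%g | y in S] = S].

(** [S] is meant to be a subgroup of [G]; it is then isomorphic to [H] iff some
    group morphism [H -> G] is a bijection of [H] onto [S]. *)
Definition isomorphic_to (G : groupType) (S : set G) (H : groupType) : Prop :=
  exists f : {multiplicative H -> G}, set_bij [set: H] S f.

Definition in_box d (L : 'I_d -> nat) (r : 'Zd_d) : bool :=
  [forall i, 0 <= r i 0 < (L i)%:Z].

Definition box d (L : 'I_d -> nat) : Type := {r : 'Zd_d | in_box L r}.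

Record rect_subst d (A : Type) := RectSubst {
  side : 'I_d -> nat;
  side_ge2 : forall i, (2 <= side i)%N;
  image :> A -> box side -> A }.

Section RectangularSubstitution.
Variables (d : nat) (A : finType) (rho : rect_subst d A).

Local Notation L := (side rho).

Definition block (m : 'Zd_d) : 'Zd_d := \col_i (m i ord0 %/ (L i)%:Z)%Z.
Definition offset (m : 'Zd_d) : 'Zd_d := \col_i (m i ord0 %% (L i)%:Z)%Z.

Lemma side_gt0 i : 0 < (L i)%:Z.
Proof. by rewrite ltz_nat (leq_trans _ (side_ge2 rho i)). Qed.

Lemma offset_in_box m : in_box L (offset m).
Proof.
apply/forallP => i; rewrite !mxE modz_ge0 ?ltz_pmod ?side_gt0 //.
by rewrite gt_eqF ?side_gt0.
Qed.

Definition offset_box m : box L := exist _ (offset m) (offset_in_box m).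

(** A pattern is a partial map [Z^d -> A]; it is [None] off its support.
    Finiteness of the support is not imposed: [iter_subst k a] has support
    [prod_i [0, L_i^k - 1]]. *)
Definition pattern : Type := 'Zd_d -> option A.

Definition subst_pattern (P : pattern) : pattern :=
  fun m => omap (fun a => rho a (offset_box m)) (P (block m)).

(** The defining equation of the extension of [rho] to patterns, with
    [Q = diag(L_1, ..., L_d)]. *)
Lemma subst_patternE (P : pattern) (n : 'Zd_d) (r : box L) :
  subst_pattern P (diag_mx (\row_i (L i)%:Z) *m n + val r)
  = omap (fun a => rho a r) (P n).
Proof.
have /forallP rP := valP r; have L0 i := side_gt0 i.
have Qn i : (diag_mx (\row_i (L i)%:Z) *m n + val r) i 0
    = n i 0 * (L i)%:Z + val r i 0.
  by rewrite mul_diag_mx !mxE mulrC.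
have -> : subst_pattern P (diag_mx (\row_i (L i)%:Z) *m n + val r)
    = omap (fun a => rho a (offset_box (diag_mx (\row_i (L i)%:Z) *m n + val r)))
        (P (block (diag_mx (\row_i (L i)%:Z) *m n + val r))) by [].
have -> : block (diag_mx (\row_i (L i)%:Z) *m n + val r) = n.
  apply/colP => i; rewrite mxE Qn divzMDl ?gt_eqF //.
  by rewrite divz_small ?addr0 // gtr0_norm // rP.
congr (omap _ _); apply/funext => a; congr (rho a _); apply/val_inj/colP => i.
by rewrite mxE Qn modzMDl modz_small // gtr0_norm // rP.
Qed.

(** The letter [a] as a pattern supported on the origin. *)
Definition letter_pattern (a : A) : pattern :=
  fun n => if n == 0 then Some a else None.

Definition iter_subst (k : nat) (a : A) : pattern :=
  iter k subst_pattern (letter_pattern a).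

Definition primitive_subst : Prop :=
  exists2 k, (1 <= k)%N & forall a b, exists n, iter_subst k a n = Some b.

Definition bijective_subst : Prop := forall r : box L, bijective (rho ^~ r).

(** [A^(Z^d)] with the product of the discrete topologies. *)
Definition full_shift : topologicalType :=
  {ptws 'Zd_d -> discrete_topology A}.

Definition shift (n : 'Zd_d) (x : full_shift) : full_shift :=
  fun m => x (n + m).

Definition hull : set full_shift :=
  [set x | forall F : set 'Zd_d, finite_set F ->
    exists (k : nat) (a : A) (t : 'Zd_d),
      forall n, F n -> iter_subst k a (n + t) = Some (x n)].

Definition aperiodic_subst : Prop :=
  forall x, hull x -> forall n, shift n x = x -> n = 0.

(** The topology on [set_type hull] is the one induced from [full_shift]. *)
Definition shift_space : topologicalType := set_type hull.

Lemma hull_shift n x : hull x -> hull (shift n x).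
Proof.
move=> hx F finF; have [|k [a [t ht]]] := hx [set n + m | m in F].
  exact: finite_image.
exists k, a, (n + t) => m Fm; rewrite -ht; last by exists m.
by rewrite [n + m]addrC addrA.
Qed.

Definition shift_fun (n : 'Zd_d) (x : shift_space) : shift_space :=
  exist _ (shift n (val x)) (mem_set (hull_shift n (set_mem (valP x)))).

Lemma shift_funD n m x : shift_fun n (shift_fun m x) = shift_fun (m + n) x.
Proof. by apply/val_inj/funext => p /=; rewrite /shift addrA. Qed.

Lemma shift_fun0 x : shift_fun 0 x = x.
Proof. by apply/val_inj/funext => p /=; rewrite /shift add0r. Qed.

Lemma shift_funK n : cancel (shift_fun n) (shift_fun (- n)).
Proof. by move=> x; rewrite shift_funD subrr shift_fun0. Qed.

Lemma shift_funNK n : cancel (shift_fun (- n)) (shift_fun n).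
Proof. by move=> x; rewrite shift_funD addNr shift_fun0. Qed.

Lemma shift_fun_continuous n : continuous (shift_fun n).
Proof.
apply: (@continuous_comp_initial _ shift_space full_shift val).
move=> x.
have xF := fmap_filter (val \o shift_fun n : shift_space -> full_shift)
  (nbhs_filter x).
apply/cvg_sup => i; move: x {xF}.
apply: (@continuous_comp_initial _ shift_space (discrete_topology A)
  (fun y : full_shift => y i) (val \o shift_fun n)) => x.
apply: (@continuous_comp shift_space full_shift (discrete_topology A) val
  (fun y => y (n + i))); first exact: initial_continuous.
exact: (@proj_continuous _ (fun=> discrete_topology A) (n + i)).
Qed.

Definition shift_homeo (n : 'Zd_d) : selfhomeo shift_space :=
  @SelfHomeo shift_space (shift_fun n) (shift_fun (- n))
    (shift_funK n) (shift_funNK n)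
    (@shift_fun_continuous n) (@shift_fun_continuous (- n)).

Definition shift_group : set (selfhomeo shift_space) := range shift_homeo.

Definition symmetry_group : set (selfhomeo shift_space) :=
  centraliser shift_group.

Definition extended_symmetry_group : set (selfhomeo shift_space) :=
  normaliser shift_group.

End RectangularSubstitution.

Arguments shift_homeo {d A} rho n.
Arguments shift_group {d A} rho.
Arguments symmetry_group {d A} rho.
Arguments extended_symmetry_group {d A} rho.

(* Main.v *)
Require Import Defs.
From HB Require Import structures.
From mathcomp Require Import all_boot all_order all_fingroup all_algebra.
From mathcomp Require Import all_classical all_reals all_analysis.
From mathcomp Require Import zify ring.

(** The alphabet is [A = G * {0,1,2}], on which [K = G * S_3] acts by left
    multiplication and by permutations; the permutations of [A] that commute
    with [K] are exactly the right multiplications by [G].  The substitution has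
    odd side [L = 2h+1], its columns are indexed by the centred box [[-h,h]^d],
    and the column at [c] is [k] if [c] lies in the [P]-orbit of a marked vector
    [v_k], and the identity otherwise.  The entries of the [v_k] are even with
    pairwise distinct absolute values, so [W_d] acts freely on the marked
    vectors and distinct [v_k] have distinct [W_d]-orbits.

    In balanced base [L] every [m] in [Z^d] has finitely many nonzero digits,
    and the hull is the orbit closure of the points [m |-> Phi(m) a], where
    [Phi(m)] is the product of the columns at the digits of [m].  Both [a a] and
    [a b] with [b != a] occur in every coordinate direction, hence the
    level-[k] supertiles of a point are determined up to [L^k Z^d], which gives
    aperiodicity.

    Let [f] be a homeomorphism of the hull with [sigma_n f = f sigma_(Nn)].  It
    has a finite window, and by minimality it maps the supertile grids of level
    [k] to translates of these grids.  Two points that agree on a huge supertile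
    and differ everywhere on a neighbouring one show that the slab
    [{p | (Np)_i = const}] follows the boundaries of the image grid up to a
    bounded error.  So every row of [N] has a single nonzero entry, [N] is a
    signed permutation, and the translation of the grids is bounded
    independently of [k].  After composition with a shift, [f] respects the
    grids of two consecutive large levels, and comparing them yields a map
    [t : A -> A] with [f x p = t (x (N p))] and
    [t o pi_(Nr) = pi_r o t] for all columns [r].  Freeness on the marked
    vectors gives [N in P]; then [t] commutes with [K], so [t] is in [G]. *)

Set Implicit Arguments.
Unset Strict Implicit.
Unset Printing Implicit Defensive.

Import Order.TTheory GRing.Theory Num.Theory.

Local Open Scope ring_scope.

(** * Boxes and division in Z^d *)

Section Boxes.
Variable d : nat.
Implicit Types (m n q r : 'Zd_d) (R S H : nat).

(* Restated at [int] so that [lia] recognises the operations. *)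
Lemma entry0 (i : 'I_d) : (0 : 'cV[int]_d) i 0 = 0. Proof. by rewrite mxE. Qed.
Lemma entryN m i : (- m) i 0 = - m i 0. Proof. by rewrite mxE. Qed.
Lemma entryD m n i : (m + n) i 0 = m i 0 + n i 0.
Proof. by rewrite mxE. Qed.
Lemma entryZ (a : int) m i : (a *: m) i 0 = a * m i 0.
Proof. by rewrite mxE. Qed.
Lemma entry_delta (i j : 'I_d) :
  (delta_mx i 0 : 'cV[int]_d) j 0 = if j == i then 1 else 0.
Proof. by rewrite mxE andbT; case: eqP. Qed.
Definition entryE := (entry0, entryN, entryD, entryZ).

Definition inbox R m : Prop := forall i, - R%:Z <= m i 0 <= R%:Z.

Lemma inbox0 R : inbox R 0.
Proof. by move=> i; rewrite ?entryE; lia. Qed.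

Lemma inbox_eq0 m : inbox 0 m -> m = 0.
Proof. by move=> m0; apply/colP => i; move: (m0 i); rewrite ?entryE; lia. Qed.

Lemma inboxN R m : inbox R m -> inbox R (- m).
Proof. by move=> mR i; move: (mR i); rewrite !entryE; lia. Qed.

Lemma inboxD R S m n : inbox R m -> inbox S n -> inbox (R + S) (m + n).
Proof. by move=> mR nS i; move: (mR i) (nS i); rewrite ?entryE; lia. Qed.

Lemma inbox_le R S m : (R <= S)%N -> inbox R m -> inbox S m.
Proof. by move=> RS mR i; move: (mR i); lia. Qed.

Lemma inbox_ex m : exists R, inbox R m.
Proof.
exists (\sum_i `|m i 0%R|)%N => i.
rewrite (bigD1 i) //=; set S := (\sum_(j < _ | _) _)%N.
by move: S (m i 0) => S x; lia.
Qed.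

Lemma inbox_delta i : inbox 1 (delta_mx i 0).
Proof. by move=> j; rewrite mxE; case: eqP. Qed.

Lemma inbox_finite R : finite_set (inbox R).
Proof.
pose g (u : {ffun 'I_d -> 'I_(R + R).+1}) : 'Zd_d := \col_i ((u i)%:Z - R%:Z).
apply: (@sub_finite_set _ _
  [set g u | u in [set: {ffun 'I_d -> 'I_(R + R).+1}]]%classic).
  move=> m mR; exists [ffun i => inord `|(m i 0%R + R%:Z)%R|%N] => //.
  apply/colP => i; rewrite mxE ffunE inordK; move: (mR i); lia.
exact/finite_image/finite_finset.
Qed.

Lemma finite_inbox (F : set 'Zd_d) : finite_set F ->
  exists R, forall n, F n -> inbox R n.
Proof.
case/finite_seqP => s ->; elim: s => [|m s [R IH]]; first by exists 0%N.
have [S mS] := inbox_ex m; exists (R + S)%N => n.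
rewrite /= inE => /orP[/eqP ->|/IH]; first by apply: inbox_le mS; lia.
by apply: inbox_le; lia.
Qed.

(** Balanced division by [2H + 1]: adding [H] before the floor division centres the remainder. *)
Definition bquot H m : 'Zd_d := \col_i divz (m i 0 + H%:Z) (2 * H + 1)%N%:Z.
Definition brem H m : 'Zd_d := m - (2 * H + 1)%:R *: bquot H m.

Lemma bquot_eq H m : m = (2 * H + 1)%:R *: bquot H m + brem H m.
Proof. by rewrite /brem addrC subrK. Qed.

Lemma bquot_coord H m i :
  m i 0 = (2 * H + 1)%N%:Z * bquot H m i 0 + brem H m i 0.
Proof. by rewrite {1}(bquot_eq H m) entryD entryZ natz. Qed.

Lemma brem_inbox H m : inbox H (brem H m).
Proof.
move=> i; rewrite /brem !entryE mxE natz.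
have := divz_eq (m i 0 + H%:Z) (2 * H + 1)%N%:Z.
have := @ltz_pmod (m i 0 + H%:Z) (2 * H + 1)%N%:Z.
have := @modz_ge0 (m i 0 + H%:Z) (2 * H + 1)%N%:Z.
set a := (_ %/ _)%Z; set b := (_ %% _)%Z.
lia.
Qed.

Lemma bquotDr H q r : inbox H r -> bquot H ((2 * H + 1)%:R *: q + r) = q.
Proof.
move=> rH; apply/colP => i; rewrite mxE !entryE -addrA natz mulrC.
rewrite divzMDl; last by lia.
by rewrite divz_small ?addr0 //; move: (rH i); lia.
Qed.

Lemma bremDr H q r : inbox H r -> brem H ((2 * H + 1)%:R *: q + r) = r.
Proof. by move=> rH; rewrite /brem bquotDr // addrC addKr. Qed.

End Boxes.

(** * Balanced digits and the hull *)

Section Digits.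
Variables (d h : nat) (K : finGroupType) (pi : 'Zd_d -> K).
Implicit Types (m q r : 'Zd_d).

(** Radius of a centred level-[k] supertile, whose side [(2h+1)^k] is odd. *)
Definition hrad k : nat := ((2 * h + 1) ^ k)./2.

Lemma hradE k : ((2 * h + 1) ^ k = 2 * hrad k + 1)%N.
Proof.
have : odd ((2 * h + 1) ^ k) by rewrite oddX oddD oddM orbT.
rewrite /hrad; lia.
Qed.

Lemma hradD j i : (hrad (j + i) = (2 * h + 1) ^ j * hrad i + hrad j)%N.
Proof.
have := hradE (j + i); rewrite expnD (hradE i) mulnDr muln1 mulnCA.
have := hradE j; lia.
Qed.

Lemma hrad0 : hrad 0 = 0%N. Proof. by []. Qed.

Lemma hradS k : hrad k.+1 = ((2 * h + 1) * hrad k + h)%N.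
Proof. have := hradE k.+1; rewrite expnS hradE; nia. Qed.

Lemma hrad1 : hrad 1 = h. Proof. by rewrite hradS hrad0 muln0. Qed.

Hypothesis h_gt0 : (0 < h)%N.
Hypothesis pi0 : pi 0 = 1%g.

Lemma leq_hrad k : (k <= hrad k)%N.
Proof. by elim: k => // k IH; rewrite hradS; nia. Qed.

Lemma leq_hradS k : (hrad k <= hrad k.+1)%N.
Proof. rewrite hradS; nia. Qed.

Lemma leq_hrad2 j k : (j <= k)%N -> (hrad j <= hrad k)%N.
Proof.
move/subnK <-; elim: (k - j)%N => // i IH.
by rewrite addSn (leq_trans IH) ?leq_hradS.
Qed.

(** The lowest digit is the leftmost factor: it belongs to the last substitution step. *)
Fixpoint phi_rec k m : K :=
  if k is k'.+1 then (pi (brem h m) * phi_rec k' (bquot h m))%g else 1%g.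

(* Balanced base-[2h+1] digits reach all of [Z^d]; the infinitely many leading
   zeros do not contribute because [pi 0 = 1]. *)
Definition Phi m : K := phi_rec (\sum_i `|m i 0%R|)%N m.

Lemma bquot0 : bquot h (0 : 'Zd_d) = 0.
Proof.
have := @bquotDr d h 0 0 (inbox0 _); by rewrite scaler0 addr0.
Qed.

Lemma brem0 : brem h (0 : 'Zd_d) = 0.
Proof. by rewrite /brem bquot0 scaler0 subr0. Qed.

Lemma phi_rec0 k : phi_rec k 0 = 1%g.
Proof. by elim: k => //= k IH; rewrite brem0 bquot0 IH pi0 mulg1. Qed.

Lemma bquot_inbox k m : inbox (hrad k.+1) m -> inbox (hrad k) (bquot h m).
Proof.
move=> mk i; move: (mk i) (@brem_inbox d h m i) (bquot_coord h m i).
rewrite hradS; nia.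
Qed.

Lemma phi_recD k j m : inbox (hrad k) m -> phi_rec (k + j) m = phi_rec k m.
Proof.
elim: k m => [m /inbox_eq0 ->|k IH m mk]; first by rewrite phi_rec0.
by rewrite addSn /= IH //; exact: bquot_inbox.
Qed.

Lemma inbox_sum m : inbox (\sum_i `|m i 0%R|)%N m.
Proof.
move=> i; rewrite (bigD1 i) //=; set S := (\sum_(j < _ | _) _)%N.
move: S (m i 0) => S x; lia.
Qed.

Lemma phi_recE k m : inbox (hrad k) m -> phi_rec k m = Phi m.
Proof.
move=> mk; rewrite /Phi; set s := (\sum_i _)%N.
have ms : inbox (hrad s) m by apply: inbox_le (@inbox_sum m); exact: leq_hrad.
have [ks|sk] := leqP k s; first by rewrite -(subnKC ks) phi_recD.
by rewrite -(subnKC (ltnW sk)) phi_recD.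
Qed.

Lemma Phi0 : Phi 0 = 1%g. Proof. exact: phi_rec0. Qed.

Lemma inbox_hrad m : exists k, inbox (hrad k) m.
Proof.
by have [R mR] := inbox_ex m; exists R; apply: inbox_le mR; exact: leq_hrad.
Qed.

Lemma PhiD1 q r : inbox h r -> Phi ((2 * h + 1)%:R *: q + r) = (pi r * Phi q)%g.
Proof.
move=> rh; have [k mk] := inbox_hrad ((2 * h + 1)%:R *: q + r).
have mk1 : inbox (hrad k.+1) ((2 * h + 1)%:R *: q + r).
  by apply: inbox_le mk; exact: leq_hradS.
have qk : inbox (hrad k) q by rewrite -(bquotDr q rh); exact: bquot_inbox.
by rewrite -(phi_recE mk1) /= bquotDr // bremDr // phi_recE.
Qed.

Lemma Phi_small r : inbox h r -> Phi r = pi r.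
Proof. by move=> rh; have := PhiD1 0 rh; rewrite scaler0 add0r Phi0 mulg1. Qed.

Lemma PhiD k q r : inbox (hrad k) r ->
  Phi (((2 * h + 1) ^ k)%:R *: q + r) = (Phi r * Phi q)%g.
Proof.
elim: k q r => [q r /inbox_eq0 ->|k IH q r rk].
  by rewrite expn0 scale1r addr0 Phi0 mul1g.
rewrite [in LHS](@bquot_eq _ h r) addrA expnS natrM -scalerA -scalerDr.
rewrite PhiD1 ?IH ?mulgA; [|exact: bquot_inbox|exact: brem_inbox].
by rewrite -PhiD1 -?bquot_eq //; exact: brem_inbox.
Qed.

Lemma PhiZ k q : Phi (((2 * h + 1) ^ k)%:R *: q) = Phi q.
Proof. by rewrite -[X in Phi X]addr0 PhiD ?Phi0 ?mul1g //; exact: inbox0. Qed.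

End Digits.

(** * The substitution of a column map, and its hull in terms of [Phi] *)

Section Substitution.
Variables (d h : nat) (K : finGroupType) (pi : 'Zd_d -> K).
Variables (A : finType) (act : K -> A -> A).
Hypothesis h_gt0 : (0 < h)%N.
Hypothesis pi0 : pi 0 = 1%g.
Implicit Types (m q r : 'Zd_d).
Hypothesis act1 : forall a, act 1%g a = a.
Hypothesis actM : forall k l a, act (k * l)%g a = act k (act l a).

Local Notation L := (2 * h + 1)%N.
Local Notation Phi := (Phi h pi).
Local Notation hrad := (hrad h).

Lemma side_ge2L (i : 'I_d) : (2 <= L)%N. Proof. lia. Qed.

(* Columns are indexed by the centred box [[-h, h]^d], on which signed
   permutations act linearly. *)
Definition digit_subst : rect_subst d A :=
  RectSubst side_ge2L
    (fun a (b : box (fun=> L)) => act (pi (sval b - const_mx h%:Z)) a).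

Local Notation rho := digit_subst.

(** Iterates of [rho] live on [[0, L^k - 1]^d]; this is the centre of that box. *)
Definition shift_hrad k : 'Zd_d := const_mx (hrad k)%:Z.

Lemma carryE k m i : (m + shift_hrad k.+1) i ord0
  = (hrad k)%:Z * L%:Z + (m i 0 + h%:Z).
Proof. by rewrite entryD mxE hradS; lia. Qed.

Lemma iter_substE k a m : iter_subst rho k a (m + shift_hrad k) =
  if `[< inbox (hrad k) m >] then Some (act (Phi m) a) else None.
Proof.
elim: k m => [|k IH] m.
  rewrite /iter_subst /= /letter_pattern.
  have -> : shift_hrad 0 = 0 by apply/colP => i; rewrite !mxE.
  rewrite addr0; case: asboolP => [/inbox_eq0 ->|m0].
    by rewrite eqxx Phi0 // act1.
  case: eqP => // m00; case: m0; rewrite m00; exact: inbox0.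
rewrite /iter_subst iterS -/(iter_subst rho k a) /subst_pattern.
have rE : offset rho (m + shift_hrad k.+1) = brem h m + const_mx h%:Z.
  apply/colP => i; rewrite /= mxE carryE /= modzMDl /brem !entryE !mxE natz.
  move: (divz_eq (m i 0 + h%:Z) L%:Z).
  set u := divz _ _; set v := modz _ _; lia.
have -> : block rho (m + shift_hrad k.+1) = bquot h m + shift_hrad k.
  by apply/colP => i; rewrite mxE carryE /= divzMDl ?entryE ?mxE 1?addrC; lia.
rewrite IH; case: asboolP => mk /=; last first.
  by case: asboolP => // mk1; case: mk; exact: bquot_inbox.
have mk1 : inbox (hrad k.+1) m.
  move=> i; move: (mk i) (@brem_inbox d h m i) (bquot_coord h m i).
  rewrite hradS; nia.
rewrite asboolT //= rE addrK -actM -PhiD1 -?bquot_eq //; exact: brem_inbox.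
Qed.

Lemma hullP (x : full_shift d A) : hull rho x <->
  forall R, exists a t, forall n, inbox R n -> x n = act (Phi (n + t)) a.
Proof.
split=> [hx R|hx F finF].
  have [k [a [t ht]]] := hx _ (inbox_finite d R).
  exists a, (t - shift_hrad k) => n nR; have := ht n nR.
  rewrite -[n + t](subrK (shift_hrad k)) iter_substE -addrA.
  by case: asboolP => // _ [].
have [R FR] := finite_inbox finF; have [a [t xt]] := hx R.
have [S tS] := inbox_ex t.
exists (R + S)%N, a, (t + shift_hrad (R + S)) => n Fn.
rewrite addrA iter_substE asboolT ?xt //; first exact: FR.
by apply: inbox_le (inboxD (FR _ Fn) tS); exact: leq_hrad.
Qed.

End Substitution.

(** * Topology of shift spaces *)

Section Topology.
Local Open Scope classical_set_scope.
Variables (d : nat) (A : finType).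
Implicit Types (x y : full_shift d A) (R : nat).

Definition cylinder x R : set (full_shift d A) :=
  [set y | forall n, inbox R n -> y n = x n].

Lemma cylinder_nbhs x R : nbhs x (cylinder x R).
Proof.
have [s sE] := (finite_seqP (inbox R)).1 (inbox_finite d R).
suff : nbhs x [set y | forall n, n \in s -> y n = x n].
  apply: filterS => y ys n nR; apply: ys.
  by have : [set` s] n by rewrite -sE.
elim: s {sE} => [|n s IH]; first by apply: filterS filterT => y _ n.
have xn : nbhs x [set y | y n = x n].
  exact: (@proj_continuous _ (fun=> discrete_topology A) n x _
    (@discrete_set1 (discrete_topology A) (x n))).
apply: filterS (filterI xn IH) => y [yn ys] m.
by rewrite inE => /orP[/eqP ->//|]; exact: ys.
Qed.

Lemma nbhs_cylinder x U : nbhs x U -> exists R, cylinder x R `<=` U.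
Proof.
pose F := filter_from setT (cylinder x).
have FF : Filter F.
  apply: filter_fromT_filter; first by exists 0%N.
  move=> R S; exists (R + S)%N => y yRS.
  by split=> n nR; apply: yRS; apply: inbox_le nR; lia.
have : F --> (x : full_shift d A).
  apply/cvg_sup => i B /= [_ [[V oV <-] Vx VB]].
  have [R iR] := inbox_ex i; exists R => // y yx; apply: VB.
  by rewrite /= yx.
by move=> Fx /Fx [R _ RU]; exists R.
Qed.

Lemma continuous_ptws (T : topologicalType) (f : T -> full_shift d A) :
  (forall i t, \forall s \near t, f s i = f t i) -> continuous f.
Proof.
move=> fc t; apply/cvg_sup => i B /= [_ [[V oV <-] Vx VB]].
by apply: filterS (fc i t) => s fs; apply: VB; rewrite /= fs.
Qed.

Variable rho : rect_subst d A.

Lemma hull_closed : closed (hull rho).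
Proof.
move=> x hx F finF; have [R FR] := finite_inbox finF.
have [y [/(_ F finF)[k [a [t ht]]] yx]] := hx _ (cylinder_nbhs x R).
by exists k, a, t => n Fn; rewrite ht // yx //; exact: FR.
Qed.

Lemma hull_compact : compact (hull rho).
Proof.
have cA : compact [set: full_shift d A].
  have := @tychonoff _ (fun _ : 'Zd_d => discrete_topology A) (fun=> setT).
  move=> H; have {}H : compact [set f : full_shift d A | forall i, setT (f i)].
    by apply: H => i; apply: finite_compact; exact: (@finite_finset A).
  by apply: subclosed_compact H _ => //; exact: closedT.
exact: (subclosed_compact hull_closed cA).
Qed.

Lemma shift_space_nbhs (x : shift_space rho) R :
  \forall y \near x, forall n, inbox R n -> val y n = val x n.
Proof.
exact: (@initial_continuous _ _ (val : shift_space rho -> full_shift d A) x _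
  (cylinder_nbhs (val x) R)).
Qed.

Lemma continuous_shift_space (f : shift_space rho -> shift_space rho) :
  (forall i (x : shift_space rho), exists R, forall y : shift_space rho,
     (forall n, inbox R n -> val y n = val x n) ->
     val (f y) i = val (f x) i) -> continuous f.
Proof.
move=> fc; apply: (@continuous_comp_initial _ _ (full_shift d A) val).
apply: continuous_ptws => i x; have [R xR] := fc i x.
by apply: filterS (shift_space_nbhs x R) => y /xR.
Qed.

(* Curtis-Hedlund-Lyndon: by compactness, the value at the origin of a
   continuous map depends on a bounded window. *)
Lemma block_code (f : shift_space rho -> shift_space rho) : continuous f ->
  exists w, forall x y : shift_space rho,
    (forall n, inbox w n -> val x n = val y n) ->
    val (f x) 0 = val (f y) 0.
Proof.
move=> fc; have /compact_near_coveringP hcov := hull_compact.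
pose Q (R : nat) (x : full_shift d A) :=
  forall (hx : x \in hull rho) (y : shift_space rho),
  (forall n, inbox R n -> val y n = x n) ->
  val (f y) 0 = val (f (exist _ x hx)) 0.
have [|R _ RQ] := hcov nat \oo Q _.
  move=> x hx; pose X : shift_space rho := exist _ x (mem_set hx).
  have : nbhs X [set y | val (f y) 0 = val (f X) 0].
    have : nbhs X (f @^-1` [set y : shift_space rho |
        forall n, inbox 0 n -> val y n = val (f X) n]).
      exact: (fc X _ (shift_space_nbhs (f X) 0)).
    by apply: filterS => y /= yX; apply: yX; exact: inbox0.
  move=> [B [[V oV <-] Vx VB]].
  have [R RV] : exists R, cylinder x R `<=` V.
    exact: nbhs_cylinder (open_nbhs_nbhs (conj oV Vx)).
  exists (cylinder x R, [set S | (R <= S)%N]).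
    by split; [exact: cylinder_nbhs | exists R].
  move=> [y S] /= [yx RS] hy z zy.
  transitivity (val (f X) 0).
    apply: VB; apply: RV => n nR; apply: etrans (yx n nR).
    by apply: zy; exact: inbox_le nR.
  by apply/esym; apply: VB; exact: RV.
exists R => x y xy.
rewrite (RQ R (leqnn R) (val y) (set_mem (valP y)) (valP y) x xy).
by congr (val (f _) 0); exact: val_inj.
Qed.

End Topology.

(** * Supertiles *)

(** Serves as the limit argument in [desubst]. *)
Lemma infinite_pigeonhole (T : choiceType) (D : set T) (f : nat -> T) :
  finite_set D -> (forall n, D (f n)) ->
  exists c, forall n0, exists2 n, (n0 <= n)%N & f n = c.
Proof.
case/finite_seqP => s -> fs; apply: contrapT => /forallNP noc.
suff [n0 n0P] : exists n0, forall n, (n0 <= n)%N -> f n \notin s.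
  by have := n0P n0 (leqnn _); rewrite (fs n0).
elim: s {fs} => [|c s [n0 n0P]]; first by exists 0%N.
have /existsNP[n1 n1P] := noc c; exists (maxn n0 n1) => n.
rewrite geq_max inE => /andP[n0n n1n]; rewrite negb_or n0P // andbT.
by apply/eqP => fnc; apply: n1P; exists n.
Qed.

Lemma additive_mx d (u : 'Zd_d -> 'Zd_d) : {morph u : n m / n + m} ->
  exists N, forall n, u n = N *m n.
Proof.
move=> uD.
have u0 : u 0 = 0 by apply: (@addrI _ (u 0)); rewrite -uD !addr0.
have uN n : u (- n) = - u n by apply/eqP; rewrite -addr_eq0 -uD addNr u0.
have uZn (k : nat) n : u (k%:Z *: n) = k%:Z *: u n.
  by elim: k => [|k IH]; rewrite ?scale0r // intS !scalerDl !scale1r uD IH.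
have uZ (k : int) n : u (k *: n) = k *: u n.
  by case: k => k; rewrite ?NegzE ?scaleNr ?uN uZn.
exists (\matrix_(i, j) u (delta_mx j 0) i 0) => n.
have nE : n = \sum_j n j 0 *: delta_mx j 0.
  by rewrite {1}(matrix_sum_delta n); apply: eq_bigr => j _; rewrite big_ord1.
rewrite {1}nE (big_morph u uD u0); apply/colP => i; rewrite summxE mxE.
by apply: eq_bigr => j _; rewrite uZ !mxE mulrC.
Qed.

Lemma mulmx_can_eq d (N M : 'M[int]_d) :
  (forall n : 'Zd_d, N *m n = M *m n) -> N = M.
Proof.
move=> NM; apply/matrixP => i j.
have := congr1 (fun u : 'Zd_d => u i 0) (NM (delta_mx j 0)).
by rewrite -!colE !mxE.
Qed.

Lemma mulmx_can d (N M : 'M[int]_d) :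
  (forall n : 'Zd_d, N *m (M *m n) = n) -> N *m M = 1%:M.
Proof. by move=> NM; apply: mulmx_can_eq => n; rewrite -mulmxA NM mul1mx. Qed.

Section Hull.
Variables (d h : nat) (K : finGroupType) (pi : 'Zd_d -> K).
Variables (A : finType) (act : K -> A -> A).
Hypothesis h_gt0 : (0 < h)%N.
Hypothesis pi0 : pi 0 = 1%g.
Hypothesis act1 : forall a, act 1%g a = a.
Hypothesis actM : forall k l a, act (k * l)%g a = act k (act l a).
Hypothesis act_trans : forall a b, exists k, act k a = b.
Hypothesis pi_onto : forall k, exists2 v, inbox h v & pi v = k.
Hypothesis pi_delta : forall i, pi (delta_mx i 0) = 1%g.
Hypothesis pi_step : forall i, exists r, [/\ inbox h r,
  inbox h (r - delta_mx i 0), pi (r - delta_mx i 0) = 1%g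
  & exists a, act (pi r) a != a].
Implicit Types (m n q r c : 'Zd_d) (a b : A).

Local Notation L := (2 * h + 1)%N.
Local Notation Phi := (Phi h pi).
Local Notation hrad := (hrad h).
Local Notation rho := (digit_subst pi act h_gt0).
Local Notation "''L_' k" := ((L ^ k)%:R : int) (at level 8, k at level 2).

Lemma actK k : cancel (act k) (act k^-1%g).
Proof. by move=> a; rewrite -actM mulVg act1. Qed.

Lemma actKV k : cancel (act k^-1%g) (act k).
Proof. by move=> a; rewrite -actM mulgV act1. Qed.

Lemma act_inj k : injective (act k).
Proof. exact: can_inj (actK k). Qed.

Lemma bquotE k m : m = 'L_k *: bquot (hrad k) m + brem (hrad k) m.
Proof. by rewrite hradE; exact: bquot_eq. Qed.

Let hullE := hullP h_gt0 pi0 act1 actM.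

Lemma Phi_hull a : hull rho (fun m => act (Phi m) a).
Proof. by apply/hullE => R; exists a, 0 => n _; rewrite addr0. Qed.

(* [x] is tiled by level-[k] supertiles centred at the points of
   [c + L^k Z^d]. *)
Definition tiled k c (x : full_shift d A) := forall n r, inbox (hrad k) r ->
  x (c + 'L_k *: n + r) = act (Phi r) (x (c + 'L_k *: n)).

Lemma tiledD k c s x : tiled k c x -> tiled k (c + 'L_k *: s) x.
Proof.
by move=> xc n r rk; rewrite -(addrA c) -scalerDr xc.
Qed.

Lemma tiled_shift k c n x : tiled k (n + c) x -> tiled k c (Defs.shift n x).
Proof. by move=> xc m r rk; rewrite /Defs.shift !addrA; exact: xc. Qed.

Lemma tiled_Phi k a : tiled k 0 (fun m => act (Phi m) a).
Proof. by move=> n r rk; rewrite !add0r PhiD // PhiZ // actM. Qed.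

(** The centre of a level-[k] supertile is also the centre of a level-[j] one, so [c] is kept; [q]
    indexes the large tile and [e] the small tile inside it. *)
Lemma tiled_le j k c x : (j <= k)%N -> tiled k c x -> tiled j c x.
Proof.
move=> jk xc n r rj.
have Ljk : 'L_k = 'L_j * 'L_(k - j) by rewrite -natrM -expnD subnKC.
have [q [e [nE ek]]] : exists q e,
    n = 'L_(k - j) *: q + e /\ inbox (hrad (k - j)) e.
  exists (bquot (hrad (k - j)) n), (brem (hrad (k - j)) n); split;
    by [exact: bquotE | exact: brem_inbox].
have ik s : inbox (hrad j) s -> inbox (hrad k) ('L_j *: e + s).
  rewrite -(subnKC jk) hradD => sj; apply: inboxD => // i.
  by move: (ek i); rewrite entryZ natz; nia.
have E s : c + 'L_j *: n + s = c + 'L_k *: q + ('L_j *: e + s).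
  by rewrite nE scalerDr scalerA -Ljk !addrA.
rewrite E xc; last exact: ik.
rewrite PhiD // actM; congr act.
rewrite -[c + 'L_j *: n]addr0 E xc; first by rewrite addr0 PhiZ.
by apply: ik; exact: inbox0.
Qed.

Lemma desubst k x : hull rho x ->
  exists c, hull rho (fun n => x (c + 'L_k *: n)) /\ tiled k c x.
Proof.
move=> /hullE hx.
have /choice[f fP] : forall R, exists p : A * 'Zd_d,
    forall n, inbox R n -> x n = act (Phi (n + p.2)) p.1.
  by move=> R; have [a [t xt]] := hx R; exists (a, t).
pose q R := bquot (hrad k) (f R).2.
(* A window only allows finitely many offsets of the level-[k] grid; [c] is one that recurs for
   arbitrarily large [R]. *)
have [c cP] := @infinite_pigeonhole _ _ (fun R => - brem (hrad k) (f R).2)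
  (inbox_finite d (hrad k)) (fun R => inboxN (brem_inbox (hrad k) (f R).2)).
have xE S : exists R, forall n r, inbox S (c + 'L_k *: n + r) ->
    inbox (hrad k) r ->
    x (c + 'L_k *: n + r) = act (Phi r) (act (Phi (n + q R)) (f R).1).
  have [R SR cR] := cP S; exists R => n r nS rk.
  rewrite (fP R); last exact: inbox_le nS.
  rewrite -actM -(PhiD h_gt0 pi0 _ rk); congr (act (Phi _) _).
  rewrite {1}(bquotE k (f R).2) -/(q R) -cR.
  by apply/colP => i; rewrite !entryE; ring.
exists c; split.
  apply/hullE => R.
  have [S cS] : exists S, forall n, inbox R n -> inbox S (c + 'L_k *: n).
    have [T cT] := inbox_ex c; exists (T + L ^ k * R)%N => n nR.
    apply: inboxD => // i; move: (nR i); rewrite entryZ natz; nia.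
  have [R' xR'] := xE S; exists (f R').1, (q R') => n nR.
  have := xR' n 0; rewrite !addr0 Phi0 // act1; apply; first exact: cS.
  exact: inbox0.
move=> n r rk.
have [S nS] := inbox_ex (c + 'L_k *: n); have [T rT] := inbox_ex r.
have [R xR] := xE (S + T)%N; rewrite xR //; last exact: inboxD.
have := xR n 0; rewrite !addr0 Phi0 // act1 => -> //; last exact: inbox0.
by apply: inbox_le nS; lia.
Qed.

(** Minimality: columns realise all of [K], which is transitive on letters, so every level-[(j+1)]
    supertile contains a level-[j] supertile of each type. *)
Lemma hull_repetitive x R a t : hull rho x ->
  exists s, forall n, inbox R n -> x (n + s) = act (Phi (n + t)) a.
Proof.
move=> /hullE hx; have [T tT] := inbox_ex t.
(* [S] bounds the displacement [s], so that the copy stays in the window on which [x] is known. *)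
pose j := (R + T)%N; pose S := (hrad j.+1 + L ^ j * h + T)%N.
have [b [u xu]] := hx (R + S)%N.
pose p := bquot (hrad j.+1) u.
have [k kP] := act_trans (act (Phi p) b) a; have [v vh vk] := pi_onto k.
pose s := t - u + 'L_j.+1 *: p + 'L_j *: v.
have sS : inbox S s.
  have -> : s = - brem (hrad j.+1) u + 'L_j *: v + t.
    rewrite /s {1}(bquotE j.+1 u) -/p.
    by apply/colP => i; rewrite !entryE; ring.
  apply: inboxD => //; apply: inboxD; first exact/inboxN/brem_inbox.
  by move=> i; move: (vh i); rewrite entryZ natz; nia.
exists s => n nR; rewrite xu; last exact: inboxD.
have -> : n + s + u = 'L_j *: (L%:R *: p + v) + (n + t).
  rewrite /s scalerDr scalerA -natrM -expnSr.
  by apply/colP => i; rewrite !entryE; ring.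
rewrite PhiD //; last by apply: inbox_le (inboxD nR tT); exact: leq_hrad.
by rewrite PhiD1 // vk !actM kP.
Qed.

(** Otherwise an occurrence of [a a] would force [k] to fix [a], and one of [a], [act (pi r) a]
    would force it to move [a]. *)
Lemma hull_nondet x i k e : hull rho x -> e = 1 \/ e = -1 ->
  exists n, x (n + e *: delta_mx i 0) <> act k (x n).
Proof.
move=> hx; wlog -> : k e / e = 1 => [H [->|->]|_].
- exact: H (or_introl erefl).
- have [n nP] := H k^-1%g 1 erefl (or_introl erefl).
  exists (n + 1 *: delta_mx i 0) => xE; apply: nP.
  by rewrite -[LHS](actK k) -xE scale1r scaleN1r addrK.
apply: contrapT => /forallNP xk.
have {}xk n : x (n + delta_mx i 0) = act k (x n).
  by have /contrapT := xk n; rewrite scale1r.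
have [r [rh rh' pir' [a ra]]] := pi_step i.
have [s sP] := hull_repetitive 1 a 0 hx.
have [s' sP'] := hull_repetitive 1 a (r - delta_mx i 0) hx.
have dh : inbox h (delta_mx i 0 : 'Zd_d).
  by apply: inbox_le (inbox_delta i); lia.
have := sP 0 (inbox0 _); rewrite !add0r Phi0 // act1 => xs.
have := sP _ (inbox_delta i).
rewrite [_ + s]addrC xk xs addr0 Phi_small // pi_delta act1 => ka.
have := sP' 0 (inbox0 _); rewrite !add0r Phi_small // pir' act1 => xs'.
have := sP' _ (inbox_delta i).
rewrite [_ + s']addrC xk xs' ka addrC subrK Phi_small // => /esym/eqP.
exact/negP.
Qed.

(** If two grids differ by [e] with a nonzero [i]-th entry, a tile of one meets two neighbouring
    tiles of the other, whose letters then differ by a fixed element of [K], against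
    [hull_nondet]. *)
Lemma tiled_uniq k x c c' : hull rho x -> tiled k c x -> tiled k c' x ->
  exists s, c' = c + 'L_k *: s.
Proof.
move=> hx xc xc'; have [c0 [hy xc0]] := desubst k hx.
suff H u : tiled k u x -> exists s, u = c0 + 'L_k *: s.
  have [s ->] := H _ xc; have [s' ->] := H _ xc'; exists (s' - s).
  by rewrite -addrA -scalerDr [s + _]addrC subrK.
move=> {c c' xc xc'} xu; exists (bquot (hrad k) (u - c0)).
set q := bquot _ _; set e := brem (hrad k) (u - c0).
have uE : u = c0 + 'L_k *: q + e by rewrite -addrA -bquotE addrC subrK.
suff e0 : e = 0 by rewrite {1}uE e0 addr0.
have ek : inbox (hrad k) e by exact: brem_inbox.
have {}xu : tiled k (c0 + e) x.
  have := tiledD (- q) xu; rewrite uE scalerN addrAC addrK; exact.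
clearbody e; apply/colP => i; rewrite mxE; apply: contrapT => ei.
(* [o] points to the neighbour that the displaced tile meets; one common point lies at [r] from the
   neighbour's centre and at [r'] from the displaced centre. *)
pose o : int := if 0 < e i 0 then 1 else -1.
have oe : o = 1 \/ o = -1 by rewrite /o; case: ifP; [left|right].
pose r := e - (o * (hrad k + 1)%N%:Z) *: delta_mx i 0.
have rk : inbox (hrad k) r.
  move=> j; move: (ek j); rewrite /r entryD entryN entryZ entry_delta.
  have [->|_] := eqVneq j i; last by rewrite mulr0; lia.
  by rewrite /o; move: ei; case: ltP; lia.
pose r' : 'Zd_d := (o * (hrad k)%:Z) *: delta_mx i 0.
have rk' : inbox (hrad k) r'.
  move=> j; rewrite /r' entryZ entry_delta.
  by case: (j == i); rewrite /o; case: ifP; lia.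
have [n] := hull_nondet i ((Phi r)^-1 * (Phi r' * Phi e))%g hy oe.
apply; apply: (@act_inj (Phi r)); rewrite -actM mulKVg actM.
rewrite -xc0 // -[X in act _ X]xc0 //.
have := xu n r' rk'; rewrite [c0 + e + _]addrAC => <-; congr (x _).
rewrite /r /r'; apply/colP => j; rewrite !entryE natz hradE; ring.
Qed.

Lemma tiled_ex k x : hull rho x -> exists c, tiled k c x.
Proof. by move=> /(desubst k)[c [_ xc]]; exists c. Qed.

Lemma desubst_hull k x : hull rho x -> tiled k 0 x ->
  hull rho (fun n => x ('L_k *: n)).
Proof.
move=> hx x0; have [c [hy xc]] := desubst k hx.
have [s cs] := tiled_uniq hx x0 xc; rewrite add0r in cs.
have := hull_shift (- s) hy; rewrite /Defs.shift cs.
under eq_fun do rewrite -scalerDr addNKr; exact.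
Qed.

Lemma dvd_all_eq0 m : (forall k, exists s, m = 'L_k *: s) -> m = 0.
Proof.
move=> mL; have [R mR] := inbox_ex m; have [s mE] := mL R.
apply/colP => i; rewrite entry0; move: (mR i); rewrite mE entryZ natz hradE.
move: (s i 0) (leq_hrad h_gt0 R) => z RH; case: (ltrgtP z 0) => [z0|z0|->]; nia.
Qed.

(** A period preserves the level-[k] grid, hence is divisible by [L^k] for every [k]. *)
Lemma digit_subst_aperiodic : aperiodic_subst rho.
Proof.
move=> x hx n xn; apply: dvd_all_eq0 => k.
have [c xc] := tiled_ex k hx.
have := @tiled_shift k (c - n) n x; rewrite xn [n + _]addrC subrK => /(_ xc).
move=> /(tiled_uniq hx)/(_ xc)[s cE]; exists s.
by apply: (@addrI _ (c - n)); rewrite subrK -cE.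
Qed.

Lemma hull_pattern a x R : hull rho x ->
  exists t, forall n, inbox R n -> x n = act (Phi (n + t)) a.
Proof.
move=> /hullE /(_ R)[b [t xt]]; have [T tT] := inbox_ex t.
have [k ka] := act_trans a b; have [v vh vk] := pi_onto k.
exists (t + 'L_(R + T) *: v) => n nR.
rewrite addrA addrC PhiD //; last first.
  by apply: inbox_le (inboxD nR tT); exact: leq_hrad.
by rewrite actM (Phi_small h_gt0 pi0 vh) vk ka xt.
Qed.

Local Notation X := (shift_space rho).

Definition fixpt a : X :=
  exist _ (fun m => act (Phi m) a) (mem_set (Phi_hull a)).

Lemma fixptE a n : val (fixpt a) n = act (Phi n) a. Proof. by []. Qed.

Lemma val_hull (x : X) : hull rho (val x). Proof. exact: set_mem (valP x). Qed.

Lemma val_shift n (x : X) m : val (shift_fun n x) m = val x (n + m).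
Proof. by []. Qed.

Implicit Types x y : X.

(** * Homeomorphisms that intertwine the shifts through a matrix *)

Section Rigidity.
Variables (f g : X -> X) (N M : 'M[int]_d) (w : nat) (a0 : A).
Hypotheses (fK : cancel f g) (gK : cancel g f).
Hypotheses (NM : N *m M = 1%:M) (MN : M *m N = 1%:M).
Hypothesis fN : forall n x, shift_fun n (f x) = f (shift_fun (N *m n) x).
Hypothesis f_window : forall x y : X,
  (forall n, inbox w n -> val x n = val y n) -> val (f x) 0 = val (f y) 0.
Hypothesis g_window : forall x y : X,
  (forall n, inbox w n -> val x n = val y n) -> val (g x) 0 = val (g y) 0.

Lemma NK n : M *m (N *m n) = n. Proof. by rewrite mulmxA MN mul1mx. Qed.
Lemma MK n : N *m (M *m n) = n. Proof. by rewrite mulmxA NM mul1mx. Qed.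

Lemma gM n x : shift_fun n (g x) = g (shift_fun (M *m n) x).
Proof. by apply: (can_inj fK); rewrite gK -{1}(MK n) -fN gK. Qed.

Lemma fM n x : f (shift_fun n x) = shift_fun (M *m n) (f x).
Proof. by rewrite fN MK. Qed.

Lemma f_local p (x y : X) :
  (forall n, inbox w n -> val x (N *m p + n) = val y (N *m p + n)) ->
  val (f x) p = val (f y) p.
Proof.
move=> xy; rewrite -[p]addr0 -!val_shift !fN.
by apply: f_window => n nw; rewrite !val_shift; exact: xy.
Qed.

Lemma g_local p (x y : X) :
  (forall n, inbox w n -> val x (M *m p + n) = val y (M *m p + n)) ->
  val (g x) p = val (g y) p.
Proof.
move=> xy; rewrite -[p]addr0 -!val_shift !gM.
by apply: g_window => n nw; rewrite !val_shift; exact: xy.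
Qed.

Definition tiled_image k c :=
  forall x : X, tiled k 0 (val x) -> tiled k c (val (f x)).

(** One [c] serves all [x]: each finite patch of [x] reappears in [fixpt a0] displaced by a vector
    of [L^k Z^d], and [M] preserves [L^k Z^d]. *)
Lemma tiled_image_ex k : exists c, tiled_image k c.
Proof.
have [c f0c] := tiled_ex k (val_hull (f (fixpt a0))).
exists c => x x0.
have shiftE R : exists t, forall m, inbox R m ->
    val x m = val (fixpt a0) ('L_k *: t + m).
  have [t tP] := hull_pattern a0 R (desubst_hull (val_hull x) x0).
  exists t => m mR; rewrite fixptE [in LHS](bquotE k m) -[_ *: _]add0r.
  have ek := brem_inbox (hrad k) m.
  rewrite x0 // add0r tP.
    rewrite -actM -(PhiD h_gt0 pi0 _ ek); congr (act (Phi _) _).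
    by rewrite [in RHS](bquotE k m) [RHS]addrA -scalerDr [t + _]addrC.
  move=> i; have := congr1 (fun u : 'Zd_d => u i 0) (bquotE k m).
  rewrite entryD entryZ natz hradE; move: (mR i) (ek i).
  move: (hrad k) (bquot _ _ i 0) (brem _ _ i 0) => H q e; nia.
move=> n r rk; set p := c + _; have [R1 pR1] := inbox_ex (N *m p).
have [R2 pR2] := inbox_ex (N *m (p + r)).
have [t tP] := shiftE (R1 + R2 + w)%N.
have fE q : inbox (R1 + R2) (N *m q) ->
    val (f x) q = val (f (fixpt a0)) ('L_k *: (M *m t) + q).
  move=> qR; rewrite scalemxAr -val_shift -fM; apply: f_local => n' n'w.
  by rewrite val_shift; apply: tP; exact: inboxD.
rewrite !fE; last 2 first.
- by apply: inbox_le pR1; lia.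
- by apply: inbox_le pR2; lia.
have -> : 'L_k *: (M *m t) + p = c + 'L_k *: (M *m t + n).
  by rewrite /p scalerDr addrCA.
by rewrite addrA -f0c // /p scalerDr; congr (val _ _); rewrite addrCA.
Qed.

Lemma N_delta i j : (N *m delta_mx j (0 : 'I_1)) i 0 = N i j.
Proof. by rewrite -colE mxE. Qed.

Lemma M_delta i j : (M *m delta_mx j (0 : 'I_1)) i 0 = M i j.
Proof. by rewrite -colE mxE. Qed.

Let T i : nat := (\sum_j `|N i j|)%N.

(** The corner of [[-1, 1]^d] at which [(N v)_i] attains its maximum [T i]. *)
Let sgv i : 'Zd_d := \col_j (if 0 <= N i j then 1 else -1).

Lemma sgvE i j : sgv i j 0 = if 0 <= N i j then 1 else -1.
Proof. by rewrite mxE. Qed.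

Lemma N_sgv i : (N *m sgv i) i 0 = (T i)%:Z.
Proof.
have normE (z : int) : z * (if 0 <= z then 1 else -1) = `|z|%N%:Z.
  by case: ifP; lia.
rewrite mxE /T (big_morph Posz PoszD (erefl _)).
by apply: eq_bigr => j _; rewrite sgvE; exact: normE.
Qed.

Lemma sgv_inbox i R : inbox R (R%:Z *: sgv i).
Proof. by move=> j; rewrite entryZ sgvE; case: ifP; lia. Qed.

(* The two points of the hull used here agree on the level-[K] supertile at the
   origin and differ everywhere on its neighbour in direction [i]; a level-[k]
   supertile of their images lies in the agreement set or in its complement, so
   it cannot cross the strip [N^-1 {n | n_i = hrad K}] by more than [w]. *)
Lemma tile_barrier i k c s : tiled_image k c -> (w <= hrad k)%N ->
  let p := c - (hrad k)%:Z *: (M *m delta_mx i 0) + 'L_k *: s in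
  ~ (1 - (T i)%:Z * ((hrad k)%:Z - w%:Z) <= (N *m p) i 0
       <= (T i)%:Z * (hrad k)%:Z - w%:Z).
Proof.
move=> fc wk p /andP[lo hi].
(* Up to the translation [q0], [z] is a corner of an image tile whose [f]-window lies in the
   agreement set; [z'] is near the opposite corner, drawn in by [w] so that the [g]-window fits in
   the tile. *)
pose z := p + (hrad k)%:Z *: - sgv i; pose z' := p + (hrad k - w)%:Z *: sgv i.
have zi : (N *m z) i 0 <= - w%:Z.
  rewrite mulmxDr -scalemxAr mulmxN entryD entryZ entryN N_sgv.
  by move: (T i) ((N *m p) i 0) hi => t l; nia.
have z'i : 1 <= (N *m z') i 0.
  rewrite mulmxDr -scalemxAr entryD entryZ N_sgv.
  by move: (T i) ((N *m p) i 0) lo => t l; nia.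
have [S1 zS1] := inbox_ex (N *m z); have [S2 zS2] := inbox_ex (N *m z').
pose j := (S1 + S2 + w)%N; pose B := hrad (k + j).
have BS : (S1 + S2 + w <= B)%N.
  by apply: (leq_trans (leq_hrad h_gt0 _)); apply: leq_hrad2; rewrite ?leq_addl.
have [r [rh rh' pir' [a ra]]] := pi_step i.
(* In [x] the supertiles at [0] and [delta_mx i 0] both carry [a]; in [y] they carry [a] and
   [act (pi r) a]. *)
pose x := fixpt a; pose y : X := shift_fun ('L_(k + j) *: (r - delta_mx i 0)) x.
have xt : tiled (k + j) 0 (val x) by exact: tiled_Phi.
have yt : tiled (k + j) 0 (val y).
  by apply: tiled_shift; rewrite addr0 -[_ *: _]add0r; exact: tiledD.
have ut := fc x (tiled_le (leq_addr j k) xt).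
have vt := fc y (tiled_le (leq_addr j k) yt).
pose q0 : 'Zd_d := B%:Z *: (M *m delta_mx i 0).
have Nq0 u : N *m (q0 + u) = B%:Z *: delta_mx i 0 + N *m u.
  by rewrite mulmxDr -scalemxAr MK.
pose s' := (hrad j)%:Z *: (M *m delta_mx i 0) + s.
have cE : q0 + p = c + 'L_k *: s'.
  rewrite /q0 /p /s' /B hradD PoszD PoszM natz scalerDr scalerA scalerDl.
  by apply/colP => l; rewrite !entryE; ring.
have agree : val (f x) (q0 + z) = val (f y) (q0 + z).
  apply: f_local => n nw; rewrite Nq0; set m := _ + n.
  have mB : inbox B m.
    move=> l; rewrite /m !entryD entryZ entry_delta.
    move: (zS1 l) (nw l) zi BS; move: (N *m z) (B) => Nz B'.
    by case: eqP => [->|_]; [move: (Nz i 0)|move: (Nz l 0) (Nz i 0)]; lia.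
  by rewrite val_shift !fixptE PhiD // (Phi_small h_gt0 pi0 rh') pir' mulg1.
have zE : q0 + z = c + 'L_k *: s' + (hrad k)%:Z *: - sgv i.
  by rewrite -cE /z addrA.
move: agree; rewrite zE scalerN.
have sgk := inboxN (sgv_inbox i (hrad k)).
rewrite ut // vt // => /act_inj uv.
have : val (g (f x)) (N *m (q0 + z')) = val (g (f y)) (N *m (q0 + z')).
  apply: g_local => n nw; rewrite NK /z' addrA cE -addrA.
  have ek : inbox (hrad k) ((hrad k - w)%:Z *: sgv i + n).
    by apply: inbox_le (inboxD (sgv_inbox i _) nw); lia.
  by rewrite ut // vt // uv.
rewrite !fK Nq0; set m := _ + N *m z'.
pose e := m - 'L_(k + j) *: delta_mx i 0.
have eB : inbox B e.
  move=> l; rewrite /e /m !entryD entryN !entryZ entry_delta natz hradE -/B.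
  move: (zS2 l) z'i BS; move: (N *m z') (B) => Nz B'.
  by case: eqP => [->|_]; [move: (Nz i 0)|move: (Nz l 0) (Nz i 0)]; lia.
have mE : m = 'L_(k + j) *: delta_mx i 0 + e by rewrite /e addrC subrK.
have dh : inbox h (delta_mx i 0 : 'Zd_d).
  by apply: inbox_le (inbox_delta i); lia.
have mE' : 'L_(k + j) *: (r - delta_mx i 0) + m = 'L_(k + j) *: r + e.
  by rewrite mE addrA -scalerDr subrK.
rewrite val_shift !fixptE mE' mE PhiD // PhiD // !actM => /act_inj.
rewrite (Phi_small h_gt0 pi0 dh) (Phi_small h_gt0 pi0 rh) pi_delta act1.
by move=> /esym/eqP; exact/negP.
Qed.

(* If row [i] had two nonzero entries, a step of [p] by [L^k] in direction [j]
   would change [(N p)_i] by less than the length of the interval forbidden by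
   [tile_barrier]. *)
Lemma row_single i j j' : N i j != 0 -> j' != j -> N i j' = 0.
Proof.
move=> Nij jj'; apply: contrapT => /eqP Nij'.
have NT : (`|N i j| < T i)%N.
  rewrite /T (bigD1 j) //= (bigD1 j') //=.
  by move: Nij'; rewrite -absz_gt0; lia.
(* Then [hrad k] is so large that the forbidden interval contains [|D| <= (T i - 1) L^k] consecutive
   integers. *)
pose k := (T i * w + T i + w)%N; have [c fc] := tiled_image_ex k.
have kH := leq_hrad h_gt0 k; have wH : (w <= hrad k)%N by lia.
pose b := (N *m (c - (hrad k)%:Z *: (M *m delta_mx i 0))) i 0.
pose A0 := 1 - (T i)%:Z * ((hrad k)%:Z - w%:Z).
pose D := (L ^ k)%N%:Z * N i j.
have D0 : D != 0 by rewrite mulf_neq0 // hradE; lia.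
apply: (tile_barrier (s := - divz (b - A0) D *: delta_mx j 0) fc wH (i := i)).
have -> : (N *m (c - (hrad k)%:Z *: (M *m delta_mx i 0) +
    'L_k *: (- divz (b - A0) D *: delta_mx j 0))) i 0 = A0 + modz (b - A0) D.
  rewrite mulmxDr entryD -!scalemxAr !entryZ N_delta -/b natz.
  have := divz_eq (b - A0) D; rewrite /D; lia.
have := ltz_mod (b - A0) D0; have := modz_ge0 (b - A0) D0.
have DE : (`|D| = (2 * hrad k + 1) * `|N i j|)%N by rewrite abszM hradE.
rewrite -[`|D|]abszE DE /A0; move: (modz _ _) => e.
move: kH; rewrite /k; move: (hrad k) (T i) `|N i j|%N NT => H t a at1 tH e0 eD.
nia.
Qed.

Lemma row_ex i : exists j, N i j != 0.
Proof.
apply: contrapT => /forallNP Ni0.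
have := congr1 (fun B : 'M[int]_d => B i i) NM.
rewrite !mxE eqxx big1 // => j _.
by have /negP := Ni0 j; rewrite negbK => /eqP ->; rewrite mul0r.
Qed.

Lemma col_ex j : exists i, N i j != 0.
Proof.
apply: contrapT => /forallNP Nj0.
have := congr1 (fun B : 'M[int]_d => B j j) MN.
rewrite !mxE eqxx big1 // => i _.
by have /negP := Nj0 i; rewrite negbK => /eqP ->; rewrite mulr0.
Qed.

Lemma row_mul i j m : N i j != 0 -> (N *m m) i 0 = N i j * m j 0.
Proof.
move=> Nij; rewrite mxE (bigD1 j) //= big1 ?addr0 // => j' jj'.
by rewrite (row_single Nij jj') mul0r.
Qed.

(** With one nonzero entry in row [i], [N *m M = 1] at [(i, i)] reads [N i j * M j i = 1] over the
    integers. *)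
Lemma row_unit i j : N i j != 0 -> (N i j = 1 \/ N i j = -1) /\ M j i = N i j.
Proof.
move=> Nij.
have /(congr1 (fun u : 'Zd_d => u i 0)) := MK (delta_mx i 0).
rewrite (row_mul _ Nij) M_delta entry_delta eqxx => e1.
have := congr1 absz e1; rewrite abszM => /eqP; rewrite muln_eq1.
by move=> /andP[/eqP ? /eqP ?]; split; [|move: e1]; nia.
Qed.

Lemma N_inbox R m : inbox R m -> inbox R (N *m m).
Proof.
move=> mR i; have [j Nij] := row_ex i; rewrite (row_mul _ Nij).
by have [[->|->] _] := row_unit Nij; move: (mR j); lia.
Qed.

Lemma brem_tiled_image k c :
  tiled_image k c -> (w <= hrad k)%N -> inbox w (brem (hrad k) c).
Proof.
move=> fc wk j; have [i Nij] := col_ex j.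
have [eN eM] := row_unit Nij.
have T1 : T i = 1%N.
  rewrite /T (bigD1 j) //= big1 ?addn0; last first.
    by move=> j' jj'; rewrite (row_single Nij jj').
  by case: eN => ->.
(* For [e] the [j]-th entry of the remainder, [o = 0] gives [N i j * e <= w] and [o = 1] gives
   [N i j * e >= - w]. *)
have barrier (o : int) := @tile_barrier i k c
  (- bquot (hrad k) c + (o * N i j) *: delta_mx j 0) fc wk.
move: (brem_inbox (hrad k) c j) (barrier 0) (barrier 1).
lazy zeta; rewrite !(row_mul _ Nij) T1 !entryD entryN !entryZ.
rewrite !entryD !entryN !entryZ.
rewrite !M_delta !entry_delta eqxx eM (bquot_coord (hrad k) c j) natz hradE.
move: (brem _ _ j 0) (bquot _ _ j 0) => e q.
by case: eN => ->; lia.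
Qed.

Lemma tiled_image_inbox k : (w <= hrad k)%N -> exists2 n, inbox w n &
  forall x, tiled k 0 (val x) -> tiled k n (val (f x)).
Proof.
move=> wk; have [c fc] := tiled_image_ex k.
exists (brem (hrad k) c); first exact: brem_tiled_image.
move=> x /fc; rewrite {1}(bquotE k c) addrC => /(tiledD (- bquot (hrad k) c)).
by rewrite scalerN addrK.
Qed.

Lemma is_signed_perm_N : is_signed_perm_mx N.
Proof.
have /choice[s sP] := row_ex.
have s_inj : injective s.
  move=> i i' ss; apply: contrapT => /eqP ii'.
  have := congr1 (fun u : 'Zd_d => u i 0) (MK (delta_mx i' 0)).
  rewrite (row_mul _ (sP i)) M_delta ss (row_unit (sP i')).2 entry_delta.
  rewrite (negPf ii') => /eqP; rewrite mulf_eq0 (negPf (sP i')) orbF -ss.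
  by rewrite (negPf (sP i)).
apply/is_signed_perm_mxP; exists (perm s_inj), [ffun i => N i (s i) == -1].
apply/matrixP => i j; rewrite mxE ffunE permE.
have [<-|sj] := eqVneq (s i) j; last first.
  by rewrite mulr0n (row_single (sP i)) // eq_sym.
by have [[->|->] _] := row_unit (sP i).
Qed.

(** The clause on constant [t] is the nondegeneracy that later forces [N] into [P]. *)
Theorem rigidity : exists n (t : A -> A),
  [/\ is_signed_perm_mx N,
      forall r a, inbox h r -> t (act (pi (N *m r)) a) = act (pi r) (t a),
      (forall a b, t a = t b) -> forall a b, a = b
    & forall x p, val (f x) (n + p) = t (val x (N *m p))].
Proof.
(* The window of radius [w] around [N *m n], with [n] itself of size at most [w], then fits in a
   level-[k] supertile. *)
pose k := (w + w)%N; have kH := leq_hrad h_gt0 k.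
have [|n nw fn] := @tiled_image_inbox k.+1.
  by rewrite hradS; move: kH; rewrite /k; nia.
(* By uniqueness of grids, the centre found at level [k.+1] also works at level [k]. *)
have fnk x : tiled k 0 (val x) -> tiled k n (val (f x)).
  have [c fc] := tiled_image_ex k.
  have x0t j : tiled j 0 (val (fixpt a0)) by exact: tiled_Phi.
  have [s ->] := tiled_uniq (val_hull _) (fc _ (x0t k))
    (tiled_le (leqnSn k) (fn _ (x0t k.+1))).
  by move=> /fc; exact: tiledD.
pose F x := shift_fun n (f x).
have Ft j x : tiled j n (val (f x)) -> tiled j 0 (val (F x)).
  by move=> xn; apply: tiled_shift; rewrite addr0.
pose t a := val (F (fixpt a)) 0.
have F0 x : tiled k 0 (val x) -> val (F x) 0 = t (val x 0).
  move=> x0; rewrite /t !val_shift addr0; apply: f_local => m mw.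
  have mk : inbox (hrad k) (N *m n + m).
    by apply: inbox_le (inboxD (N_inbox nw) mw).
  by have := x0 0 _ mk; rewrite scaler0 !add0r fixptE.
have FL x m : tiled k 0 (val x) ->
    val (F x) ('L_k *: m) = t (val x ('L_k *: (N *m m))).
  move=> x0; have -> : val (F x) ('L_k *: m) =
      val (F (shift_fun ('L_k *: (N *m m)) x)) 0.
    by rewrite /F scalemxAr fM NK shift_funD !val_shift addr0 addrC.
  rewrite F0 ?val_shift ?addr0 //; apply: tiled_shift; rewrite addr0.
  by rewrite -[_ *: _]add0r; exact: tiledD.
(* The value of [F (fixpt a)] at [L^k r] is computed twice: from the level-[k] grid by [FL], and
   from the level-[k.+1] supertile at the origin. *)
have t1 r a : inbox h r -> t (act (pi (N *m r)) a) = act (pi r) (t a).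
  move=> rh; have xt j : tiled j 0 (val (fixpt a)) by exact: tiled_Phi.
  rewrite -(Phi_small h_gt0 pi0 rh) -(Phi_small h_gt0 pi0 (N_inbox rh)).
  rewrite -(PhiZ h_gt0 pi0 k) -fixptE -FL //.
  have rk : inbox (hrad k.+1) ('L_k *: r).
    by rewrite -addn1 hradD hrad1 => i; move: (rh i); rewrite entryZ natz; nia.
  have := Ft _ _ (fn _ (xt k.+1)) 0 _ rk; rewrite scaler0 !add0r => ->.
  by rewrite PhiZ.
have tPhi m a : t (act (Phi (N *m m)) a) = act (Phi m) (t a).
  have [j] := inbox_hrad h_gt0 m.
  elim: j m a => [|j IH] m a mj.
    by rewrite (inbox_eq0 mj) mulmx0 Phi0 // !act1.
  have e1 := brem_inbox h m; have e2 := N_inbox e1.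
  rewrite [in LHS](bquot_eq h m) mulmxDr -scalemxAr PhiD1 // actM t1 //.
  by rewrite IH -?actM -?PhiD1 -?bquot_eq //; exact: bquot_inbox.
have Fx x p : tiled k 0 (val x) -> val (F x) p = t (val x (N *m p)).
  move=> x0; rewrite (bquotE k p) mulmxDr -scalemxAr.
  have pk := brem_inbox (hrad k) p.
  have := Ft k x (fnk x x0) (bquot (hrad k) p) _ pk; rewrite !add0r => ->.
  by rewrite FL // -tPhi -[_ *: (N *m _)]add0r x0 ?add0r //; exact: N_inbox.
exists n, t; split=> //; first exact: is_signed_perm_N.
  move=> tt a b; have : F (fixpt a) = F (fixpt b).
    apply/val_inj/funext => p; rewrite !Fx //; exact: tiled_Phi.
  move=> /(can_inj (shift_funK n))/(can_inj fK) /(congr1 (fun x => val x 0)).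
  by rewrite !fixptE Phi0 // !act1.
move=> x p; have [s xs] := tiled_ex k (val_hull x).
have := Fx (shift_fun s x) (p - M *m s).
rewrite /F fM shift_funD !val_shift mulmxBr MK [s + _]addrC subrK => <-.
  by congr (val _ _); apply/colP => i; rewrite !entryE; ring.
by apply: tiled_shift; rewrite addr0.
Qed.

End Rigidity.

Lemma homeo_rigidity (f : selfhomeo X) (N M : 'M[int]_d) (a0 : A) :
  N *m M = 1%:M -> M *m N = 1%:M ->
  (forall n x, shift_fun n (f x) = f (shift_fun (N *m n) x)) ->
  exists n (t : A -> A),
  [/\ is_signed_perm_mx N,
      forall r a, inbox h r -> t (act (pi (N *m r)) a) = act (pi r) (t a),
      (forall a b, t a = t b) -> forall a b, a = b
    & forall x p, val (f x) (n + p) = t (val x (N *m p))].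
Proof.
move=> NM MN fN; have [w1 fw] := block_code (@homeo_continuous _ f).
have [w2 gw] := block_code (@homeo_inv_continuous _ f).
apply: (@rigidity f (homeo_inv f) N M (w1 + w2) a0) => //.
- exact: homeoK.
- exact: homeoVK.
- by move=> x y xy; apply: fw => n nw; apply: xy; apply: inbox_le nw; lia.
- by move=> x y xy; apply: gw => n nw; apply: xy; apply: inbox_le nw; lia.
Qed.

Lemma shift_fun_inj (x : X) n m : shift_fun n x = shift_fun m x -> n = m.
Proof.
move=> nm; apply/eqP; rewrite -subr_eq0; apply/eqP.
apply: (digit_subst_aperiodic (val_hull x)).
have := congr1 (shift_fun (- m)) nm; rewrite !shift_funD addrN shift_fun0.
by move=> /(congr1 val).
Qed.

(** Conjugation by [f] permutes the shifts; aperiodicity identifies shifts with vectors, so the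
    permutation is an automorphism of [Z^d]. *)
Lemma normaliser_shift (f : selfhomeo X) (a0 : A) :
  Defs.normaliser (shift_group rho) f -> exists N M : 'M[int]_d,
  [/\ N *m M = 1%:M, M *m N = 1%:M
    & forall n x, shift_fun n (f x) = f (shift_fun (N *m n) x)].
Proof.
move=> fnorm; have x0 := fixpt a0.
have /choice[nu nuP] n : exists m,
    (shift_homeo rho n ^ f)%g = shift_homeo rho m.
  have : [set (y ^ f)%g | y in shift_group rho]%classic
      (shift_homeo rho n ^ f)%g.
    by exists (shift_homeo rho n) => //; exists n.
  by rewrite fnorm => -[m _ <-]; exists m.
have fnu n x : shift_fun n (f x) = f (shift_fun (nu n) x).
  have := congr1 (fun g => f (homeo_fun g x)) (nuP n) => /= <-.
  by rewrite homeoVK.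
have /choice[mu muP] m : exists n, nu n = m.
  have : shift_group rho (shift_homeo rho m) by exists m.
  rewrite -{1}fnorm => -[_ [n _ <-] nm]; exists n.
  apply: (@shift_fun_inj x0); rewrite nuP in nm.
  exact: (congr1 (fun g => homeo_fun g x0) nm).
have nu_inj : injective nu.
  by move=> n m nm; apply: (@shift_fun_inj (f x0)); rewrite !fnu nm.
have nuD : {morph nu : n m / n + m}.
  move=> n m; apply: (@shift_fun_inj x0); apply: (can_inj (@homeoK _ f)).
  transitivity (shift_fun (n + m) (f x0)); first by rewrite fnu.
  by rewrite addrC -(shift_funD n m) (fnu m) (fnu n) shift_funD addrC.

have muD : {morph mu : n m / n + m}.
  by move=> n m; apply: nu_inj; rewrite nuD !muP.
have [N NE] := additive_mx nuD; have [M ME] := additive_mx muD.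
exists N, M; split; last by move=> n x; rewrite -NE.
- by apply: mulmx_can => n; rewrite -ME -NE muP.
- by apply: mulmx_can => n; apply: nu_inj; rewrite -NE -ME muP.
Qed.

(** A linear map that preserves centred boxes acts digit by digit on balanced expansions. *)
Lemma Phi_sym (Q : 'M[int]_d) : (forall R m, inbox R m -> inbox R (Q *m m)) ->
  (forall r, inbox h r -> pi (Q *m r) = pi r) ->
  forall m, Phi (Q *m m) = Phi m.
Proof.
move=> Qbox Qpi m; have [j] := inbox_hrad h_gt0 m.
elim: j m => [|j IH] m mj; first by rewrite (inbox_eq0 mj) mulmx0.
have e1 := brem_inbox h m; have e2 := Qbox _ _ e1.
rewrite (bquot_eq h m) mulmxDr -scalemxAr !PhiD1 // Qpi // IH //.
exact: bquot_inbox.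
Qed.

Lemma hull_sym (Q Q' : 'M[int]_d) (t : A -> A) n (x : full_shift d A) :
  (forall R m, inbox R m -> inbox R (Q *m m)) ->
  (forall r, inbox h r -> pi (Q *m r) = pi r) -> Q *m Q' = 1%:M ->
  (forall k a, t (act k a) = act k (t a)) ->
  hull rho x -> hull rho (fun p => t (x (Q *m (n + p)))).
Proof.
move=> Qbox Qpi QQ' tact hx; apply/hullE => R.
have [S nS] := inbox_ex n; have /hullE/(_ (S + R)%N)[a [u xu]] := hx.
exists (t a), (n + Q' *m u) => p pR.
rewrite xu; last exact/Qbox/inboxD.
have uE : Q *m (Q' *m u) = u by rewrite mulmxA QQ' mul1mx.
rewrite tact -[in LHS]uE -mulmxDr Phi_sym //.
by congr (act (Phi _) _); rewrite [n + p]addrC addrA.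
Qed.

(** Letter maps commuting with [act] keep every supertile grid, so [n] preserves all grids. *)
Lemma hull_letter_shift (x : full_shift d A) (t : A -> A) n : hull rho x ->
  (forall k a, t (act k a) = act k (t a)) ->
  (forall p, x (n + p) = t (x p)) -> n = 0.
Proof.
move=> hx tact xt; apply: dvd_all_eq0 => k; have [c xc] := tiled_ex k hx.
have yc : tiled k c (Defs.shift n x).
  by move=> m r rk; rewrite /Defs.shift !xt xc // tact.
have yc' : tiled k (c - n) (Defs.shift n x).
  by apply: tiled_shift; rewrite addrC subrK.
have [s cE] := tiled_uniq (hull_shift n hx) yc' yc; exists s.
by apply: (@addrI _ (c - n)); rewrite subrK -cE.
Qed.

Lemma digit_subst_primitive : primitive_subst rho.
Proof.
exists 1%N => // a b; have [k kb] := act_trans a b; have [v vh vk] := pi_onto k.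
exists (v + shift_hrad d h 1); rewrite iter_substE // asboolT ?hrad1 //.
by rewrite Phi_small // vk kb.
Qed.

Lemma digit_subst_bijective : bijective_subst rho.
Proof.
move=> r; exists (act (pi (sval r - const_mx h%:Z))^-1%g).
- exact: actK.
- exact: actKV.
Qed.

End Hull.

(** * Marked columns *)

Section SignedPermutations.
Variable d : nat.

Lemma signed_perm_mulE (M : 'M[int]_d) : is_signed_perm_mx M ->
  exists (s : 'S_d) (e : {ffun 'I_d -> bool}),
    M = \matrix_(i, j) ((-1) ^+ e i *+ (s i == j)) /\
    forall (m : 'Zd_d) i,
      (M *m m) i 0 = (if e i then - m (s i) 0 else m (s i) 0).
Proof.
move=> /is_signed_perm_mxP[s [e ->]]; exists s, e; split=> // m i.
rewrite mxE (bigD1 (s i)) //= big1 => [|j /negPf js]; rewrite mxE.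
  by rewrite eqxx addr0 mulr1n; case: (e i); rewrite ?expr1 ?mulN1r ?mul1r.
by rewrite eq_sym js mulr0n mul0r.
Qed.

Lemma signed_perm_inbox (M : 'M[int]_d) R m :
  is_signed_perm_mx M -> inbox R m -> inbox R (M *m m).
Proof.
move=> /signed_perm_mulE[s [e [_ E]]] mR i; rewrite E; case: (e i) => //.
by move: (mR (s i)); lia.
Qed.

Lemma hyperoct_mxM (M N : hyperoct d) :
  hyperoct_mx (M * N)%g = hyperoct_mx M *m hyperoct_mx N.
Proof. by []. Qed.

Lemma hyperoct_mxVK (M : hyperoct d) :
  hyperoct_mx M^-1%g *m hyperoct_mx M = 1%:M.
Proof. by rewrite -hyperoct_mxM mulVg. Qed.

End SignedPermutations.

Section Colouring.
Variables (d : nat) (K : finGroupType) (P : {group hyperoct d}).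
Hypothesis d_gt0 : (0 < d)%N.
Implicit Types (M N Q : hyperoct d) (k : K) (c r : 'Zd_d).

(* The entries are even, so that two marked columns are never adjacent, and
   their absolute values determine both [k] and the coordinate [j]. *)
Definition mark k : 'Zd_d :=
  \col_j (2 * (d * enum_rank k + j + 1))%N%:Z.

(** The marks have entries at most [2 d #|K|]; the extra one leaves room for a unit step. *)
Definition hside : nat := (2 * (d * #|K|)).+1.

Definition column c : K :=
  if [pick k | [exists M in P, c == hyperoct_mx M *m mark k]] is Some k then k
  else 1%g.

Lemma markE k (j : 'I_d) : mark k j 0 = (2 * (d * enum_rank k + j + 1))%N%:Z.
Proof. by rewrite mxE. Qed.

Lemma mark_bound k (j : 'I_d) : (d * enum_rank k + j + 1 <= d * #|K|)%N.
Proof.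
have kK : (enum_rank k < #|K|)%N by exact: ltn_ord.
by have := leq_mul (leqnn d) kK; rewrite mulnS; move: (ltn_ord j); lia.
Qed.

Lemma mark_inbox k : inbox hside.-1 (mark k).
Proof. by move=> j; rewrite markE /hside; move: (mark_bound k j); lia. Qed.

Lemma mulmx_mark_entry M k (i : 'I_d) : exists2 u : nat,
  (0 < u)%N & (hyperoct_mx M *m mark k) i 0 = 2 * u%:Z \/
              (hyperoct_mx M *m mark k) i 0 = - (2 * u%:Z).
Proof.
have [s [e [_ E]]] := signed_perm_mulE (valP M).
exists (d * enum_rank k + s i + 1)%N; first by lia.
by rewrite E !markE; case: (e i); [right|left]; lia.
Qed.

(** Marks have positive entries, so no sign occurs; division of [d * enum_rank k + j] by [d]
    recovers [k], and then [j]. *)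
Lemma mulmx_mark_inj M k k' :
  hyperoct_mx M *m mark k = mark k' -> M = 1%g /\ k = k'.
Proof.
have [s [e [ME E]]] := signed_perm_mulE (valP M) => Mk.
have kk' i : e i = false /\ (d * enum_rank k + s i = d * enum_rank k' + i)%N.
  have := congr1 (fun u : 'Zd_d => u i 0) Mk.
  by rewrite E !markE; case: (e i); lia.
have divE a i : (a < d)%N -> ((d * i + a) %/ d = i)%N.
  by move=> ad; rewrite mulnC divnMDl // divn_small ?addn0.
have rkk' : enum_rank k = enum_rank k'.
  apply: val_inj; have [_ /(congr1 (divn^~ d))] := kk' (Ordinal d_gt0).
  by rewrite !divE //; exact: ltn_ord.
split; last exact: (can_inj enum_rankK).
apply: val_inj; rewrite /= ME; apply/matrixP => i j; rewrite !mxE.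
have [-> /eqP] := kk' i; rewrite rkk' eqn_add2l => /eqP/val_inj ->.
by rewrite expr0.
Qed.

Lemma columnP c :
  (exists M k, [/\ M \in P, c = hyperoct_mx M *m mark k & column c = k])
  \/ (column c = 1%g /\ forall M k, M \in P -> c <> hyperoct_mx M *m mark k).
Proof.
rewrite /column; case: pickP => [k /exists_inP[M MP /eqP cE]|noc].
  by left; exists M, k.
right; split=> // M k MP cE; have /exists_inP[] := negbT (noc k).
by exists M => //; apply/eqP.
Qed.

Lemma column_mark M k : M \in P -> column (hyperoct_mx M *m mark k) = k.
Proof.
move=> MP; have [[M' [k' [M'P E ->]]]|[_ /(_ M k MP)//]] :=
  columnP (hyperoct_mx M *m mark k).
suff /mulmx_mark_inj[_ ->] :
  hyperoct_mx (M'^-1 * M)%g *m mark k = mark k' by [].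
by rewrite hyperoct_mxM -mulmxA E mulmxA hyperoct_mxVK mul1mx.
Qed.

Lemma column_sym Q c : Q \in P -> column (hyperoct_mx Q *m c) = column c.
Proof.
move=> QP; have [[M [k [MP -> ->]]]|[-> noc]] := columnP c.
  by rewrite mulmxA -hyperoct_mxM column_mark ?groupM.
have [[M [k [MP E _]]]|[-> //]] := columnP (hyperoct_mx Q *m c).
have [] := noc (Q^-1 * M)%g k; first by rewrite groupM ?groupV.
by rewrite hyperoct_mxM -mulmxA -E mulmxA hyperoct_mxVK mul1mx.
Qed.

Lemma column_odd c i (u : int) : c i 0 = 2 * u + 1 -> column c = 1%g.
Proof.
move=> ci; have [[M [k [MP cE _]]]|[->//]] := columnP c.
by have [v _] := mulmx_mark_entry M k i; rewrite -cE ci => ?; exfalso; lia.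
Qed.

Lemma column0 : column 0 = 1%g.
Proof.
have [[M [k [MP cE _]]]|[->//]] := columnP 0.
have [v v0] := mulmx_mark_entry M k (Ordinal d_gt0); rewrite -cE mxE; lia.
Qed.

Lemma column_delta i : column (delta_mx i 0) = 1%g.
Proof. by apply: (@column_odd _ i 0); rewrite entry_delta eqxx. Qed.

Lemma column_onto k : exists2 v, inbox hside v & column v = k.
Proof.
exists (mark k); first by apply: inbox_le (mark_inbox k); exact: leq_pred.
by rewrite -[mark k]mul1mx -[1%:M]/(hyperoct_mx 1%g) column_mark.
Qed.

(** A nontrivial column at [N mark k] puts it in the [P]-orbit of some mark; freeness then
    identifies [N] with an element of [P]. *)
Lemma column_markV N k : column (hyperoct_mx N *m mark k) != 1%g -> N \in P.
Proof.
have [[M [k' [MP cE _]]] _|[-> _]] := columnP (hyperoct_mx N *m mark k);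
  last by rewrite eqxx.
have : hyperoct_mx (M^-1 * N)%g *m mark k = mark k'.
  by rewrite hyperoct_mxM -mulmxA cE mulmxA hyperoct_mxVK mul1mx.
by case/mulmx_mark_inj => /eqP; rewrite -eq_mulVg1 => /eqP <- _.
Qed.

Lemma column_step k i : k != 1%g -> exists r, [/\ inbox hside r,
  inbox hside (r - delta_mx i 0), column (r - delta_mx i 0) = 1%g
  & column r = k].
Proof.
move=> k1; exists (mark k); split.
- by apply: inbox_le (mark_inbox k); exact: leq_pred.
- have := inboxD (mark_inbox k) (inboxN (inbox_delta i)).
  by apply: inbox_le; rewrite /hside; lia.
- apply: (@column_odd _ i (d * enum_rank k + i)%N%:Z).
  by rewrite entryD entryN entry_delta eqxx markE; lia.
- by rewrite -[mark k]mul1mx -[1%:M]/(hyperoct_mx 1%g) column_mark.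
Qed.

End Colouring.

(** * Realisation *)

Section Letters.
Variable G : finGroupType.

(* The inverse turns the right action of permutations into a left action. *)
Definition letter_act (k : G * {perm 'I_3}) (a : G * 'I_3) : G * 'I_3 :=
  ((k.1 * a.1)%g, (k.2^-1)%g a.2).

Definition letter_mul (g : G) (a : G * 'I_3) : G * 'I_3 :=
  ((a.1 * g^-1)%g, a.2).

Lemma letter_act1 a : letter_act 1%g a = a.
Proof. by case: a => g b; rewrite /letter_act /= mul1g invg1 perm1. Qed.

Lemma letter_actM k l a :
  letter_act (k * l)%g a = letter_act k (letter_act l a).
Proof. by rewrite /letter_act /= mulgA invMg permM. Qed.

Lemma letter_act_trans a b : exists k, letter_act k a = b.
Proof.
exists ((b.1 * a.1^-1)%g, tperm a.2 b.2).
by case: a b => [g i] [g' i']; rewrite /letter_act /= mulgKV tpermV tpermL.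
Qed.

Lemma letter_act_nontriv : exists k, exists a, letter_act k a != a.
Proof.
exists (1%g, tperm ord0 ord_max), (1%g, ord0).
by rewrite /letter_act /= tpermV tpermL xpair_eqE andbC.
Qed.

Lemma letter_mulM g h a :
  letter_mul (g * h)%g a = letter_mul g (letter_mul h a).
Proof. by rewrite /letter_mul /= invMg mulgA. Qed.

Lemma letter_mul1 a : letter_mul 1%g a = a.
Proof. by case: a => g b; rewrite /letter_mul /= invg1 mulg1. Qed.

Lemma letter_mulC g k a :
  letter_mul g (letter_act k a) = letter_act k (letter_mul g a).
Proof. by rewrite /letter_mul /letter_act /= mulgA. Qed.

Lemma letter_mul_free g h a : letter_mul g a = letter_mul h a -> g = h.
Proof. by case=> /mulgI/invg_inj. Qed.

(* A point of ['I_3] is the only fixed point of its stabiliser in ['S_3]. *)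
Lemma letter_centraliser (t : G * 'I_3 -> G * 'I_3) :
  (forall k a, t (letter_act k a) = letter_act k (t a)) ->
  exists g, t =1 letter_mul g.
Proof.
move=> tC.
have tb b : (t (1%g, b)).2 = b.
  apply: contrapT => /eqP cb; set c := (t (1%g, b)).2 in cb *.
  (* With three points, the transposition of [c] and some [z] fixes [b] and moves [c]. *)
  have [z /andP[zb zc]] : exists z : 'I_3, (z != b) && (z != c).
    apply/existsP; rewrite -[X in is_true X]negbK negb_exists.
    apply/negP => /forallP H.
    have : ([set: 'I_3] \subset [set b; c])%SET.
      apply/fintype.subsetP => z _; rewrite !inE.
      by have := H z; rewrite negb_and !negbK.
    by move/subset_leq_card; rewrite cardsT card_ord cards2; case: (_ != _).
  have := congr1 snd (tC (1%g, tperm c z) (1%g, b)).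
  rewrite /letter_act /= mulg1 tpermV tpermD // -/c tpermL => cz.
  by rewrite -cz eqxx in zc.
exists (t (1%g, ord0)).1^-1%g => -[g b].
have := tC (g, tperm ord0 b) (1%g, ord0).
rewrite /letter_act /letter_mul /= mulg1 tpermV tpermL => ->.
by rewrite tb tpermL invgK.
Qed.

End Letters.

(** * The two symmetry groups of the marked substitution *)

Section Realisation.
Variables (d : nat) (P : {group hyperoct d}) (K G : finGroupType) (A : finType).
Variables (act : K -> A -> A) (aut : G -> A -> A) (a0 : A).
Hypothesis d_gt0 : (0 < d)%N.
Hypothesis act1 : forall a, act 1%g a = a.
Hypothesis actM : forall k l a, act (k * l)%g a = act k (act l a).
Hypothesis act_trans : forall a b, exists k, act k a = b.
Hypothesis act_nontriv : exists k, exists a, act k a != a.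
Hypothesis aut1 : forall a, aut 1%g a = a.
Hypothesis autM : forall g h a, aut (g * h)%g a = aut g (aut h a).
Hypothesis autC : forall g k a, aut g (act k a) = act k (aut g a).
Hypothesis aut_free : forall g h a, aut g a = aut h a -> g = h.
Hypothesis aut_full : forall t : A -> A,
  (forall k a, t (act k a) = act k (t a)) -> exists g, t =1 aut g.

Local Notation h := (hside d K).
Local Notation col := (@column d K P).

Let h_gt0 : (0 < h)%N. Proof. by []. Qed.

Definition marked_subst : rect_subst d A := digit_subst col act h_gt0.

Local Notation rho := marked_subst.
Local Notation X := (shift_space rho).

Let col0 : col 0 = 1%g. Proof. exact: column0. Qed.

Let col_onto k : exists2 v, inbox h v & col v = k.
Proof. exact: column_onto. Qed.

Let col_delta i : col (delta_mx i 0) = 1%g. Proof. exact: column_delta. Qed.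

Let col_step i : exists r, [/\ inbox h r,
  inbox h (r - delta_mx i 0), col (r - delta_mx i 0) = 1%g
  & exists a, act (col r) a != a].
Proof.
have [k [a ka]] := act_nontriv.
have k1 : k != 1%g by apply: contraNneq ka => ->; rewrite act1.
have [r [rh rh' r'1 rk]] := column_step P d_gt0 i k1.
by exists r; split=> //; exists a; rewrite rk.
Qed.

Lemma marked_subst_aperiodic : aperiodic_subst rho.
Proof.
exact: (digit_subst_aperiodic col0 act1 actM
  act_trans col_onto col_delta col_step).
Qed.

Lemma marked_subst_primitive : primitive_subst rho.
Proof.
exact: (digit_subst_primitive h_gt0 col0 act1 actM
  act_trans col_onto).
Qed.

Lemma marked_subst_bijective : bijective_subst rho.
Proof. exact: (digit_subst_bijective act1 actM). Qed.

Implicit Types (n : 'Zd_d) (q : subg_of P) (g : G) (x : X).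

Lemma sdmx_signed q : is_signed_perm_mx (sdmx q).
Proof. exact: valP (sgval q). Qed.

Lemma sdmx_inj : injective (@sdmx d P).
Proof. by move=> q r qr; apply/val_inj/val_inj. Qed.

Lemma sdmxKV q : sdmx q *m sdmx q^-1%g = 1%:M.
Proof. by rewrite -sdmxM mulgV. Qed.

Lemma sdmxVK q : sdmx q^-1%g *m sdmx q = 1%:M.
Proof. by rewrite -sdmxM mulVg. Qed.

Lemma marked_hull_sym n q g x :
  hull rho (fun p => aut g (val x (sdmx q^-1%g *m (n + p)))).
Proof.
apply: (hull_sym col0 act1 actM (Q' := sdmx q)).
- by move=> R m; apply: signed_perm_inbox; exact: sdmx_signed.
- by move=> r _; apply: column_sym => //; exact: (valP q^-1%g).
- exact: sdmxVK.
- exact: autC.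
- exact: val_hull.
Qed.

Local Notation H := (lattice_sdprod P * G)%type.

(** The inverse of [z.1.2] makes this a left action, in which pure translations are the shifts. *)
Definition sym_fun (z : H) x : X :=
  exist _ (fun p => aut z.2 (val x (sdmx (z.1.2)^-1%g *m (z.1.1 + p))))
    (mem_set (marked_hull_sym z.1.1 z.1.2 z.2 x)).

Lemma sym_funE (z : H) x p : val (sym_fun z x) p =
  aut z.2 (val x (sdmx (z.1.2)^-1%g *m (z.1.1 + p))).
Proof. by []. Qed.

Lemma sym_funM (z w : H) x : sym_fun (z * w)%g x = sym_fun z (sym_fun w x).
Proof.
apply/val_inj/funext => p; rewrite !sym_funE -autM.
congr (aut _ (val x _)).
case: z w => [[n q] g] [[m r] k] /=.
rewrite invMg sdmxM -mulmxA; congr (_ *m _).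
have -> : n + sdmx q *m m + p = sdmx q *m m + (n + p) by rewrite addrAC addrC.
by rewrite mulmxDr mulmxA sdmxVK mul1mx.
Qed.

Lemma sym_fun1 x : sym_fun 1%g x = x.
Proof.
apply/val_inj/funext => p; rewrite sym_funE aut1 /=.
by rewrite invg1 sdmx1 mul1mx add0r.
Qed.

Lemma sym_funK (z : H) : cancel (sym_fun z) (sym_fun z^-1%g).
Proof. by move=> x; rewrite -sym_funM mulVg sym_fun1. Qed.

Lemma sym_funVK (z : H) : cancel (sym_fun z^-1%g) (sym_fun z).
Proof. by move=> x; rewrite -sym_funM mulgV sym_fun1. Qed.

Lemma sym_fun_continuous (z : H) : continuous (sym_fun z).
Proof.
apply: continuous_shift_space => i x.
have [R iR] := inbox_ex (sdmx (z.1.2)^-1%g *m (z.1.1 + i)).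
by exists R => y yx; rewrite !sym_funE yx.
Qed.

Definition sym_homeo (z : H) : selfhomeo X :=
  SelfHomeo (sym_funK z) (sym_funVK z)
    (@sym_fun_continuous z) (@sym_fun_continuous z^-1%g).

Lemma sym_homeoM : {morph sym_homeo : z w / (z * w)%g}.
Proof. by move=> z w; apply: selfhomeo_eq => x; exact: sym_funM. Qed.

HB.instance Definition _ :=
  isMultiplicative.Build H (selfhomeo X) sym_homeo sym_homeoM.

Lemma shift_sym_homeo n (z : H) x : shift_fun n (sym_homeo z x) =
  sym_homeo z (shift_fun (sdmx (z.1.2)^-1%g *m n) x).
Proof.
apply/val_inj/funext => p; rewrite val_shift !sym_funE val_shift.
by rewrite -mulmxDr addrCA.
Qed.

Lemma sym_homeo_inj : injective sym_homeo.
Proof.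
move=> z w zw; pose x0 := fixpt h_gt0 col0 act1 actM a0.
(* The rotation is read off from how the map intertwines the shifts. *)
have qE : (z.1.2)^-1%g = (w.1.2)^-1%g.
  apply/sdmx_inj/mulmx_can_eq => n.
  apply: (shift_fun_inj col0 act1 actM
    act_trans col_onto col_delta col_step (x := x0)).
  apply: (can_inj (homeoK (sym_homeo z))).
  by rewrite -shift_sym_homeo zw shift_sym_homeo.
have zwE p : aut z.2 (val x0 (sdmx (z.1.2)^-1%g *m z.1.1 + p)) =
             aut w.2 (val x0 (sdmx (z.1.2)^-1%g *m w.1.1 + p)).
  have := congr1 (fun f : selfhomeo X => val (f x0) (sdmx z.1.2 *m p)) zw.
  by rewrite /= -qE !mulmxDr !mulmxA sdmxVK !mul1mx.
(* With equal rotations, the translations differ by a shift that acts as a letter map. *)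
have nE : sdmx (z.1.2)^-1%g *m (z.1.1 - w.1.1) = 0.
  apply: (hull_letter_shift col0 act1 actM
    act_trans col_onto col_delta col_step
    (x := val (shift_fun (sdmx (z.1.2)^-1%g *m w.1.1) x0))
    (t := aut (z.2^-1 * w.2)%g)).
  - exact: val_hull.
  - exact: autC.
  move=> p; rewrite !val_shift autM -zwE -autM mulVg aut1.
  by rewrite addrA mulmxBr addrC [_ + (_ - _)]addrC subrK addrC.
have n12 : z.1.1 = w.1.1.
  apply/eqP; rewrite -subr_eq0; apply/eqP.
  by rewrite -[LHS]mul1mx -(sdmxKV z.1.2) -mulmxA nE mulmx0.
have := zwE 0; rewrite n12 => /aut_free.
by case: z w qE n12 {zw zwE nE} => [[n q] g] [[m r] k] /= /invg_inj -> -> ->.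
Qed.

Lemma homeo_sym (f : selfhomeo X) (N M : 'M[int]_d) :
  N *m M = 1%:M -> M *m N = 1%:M ->
  (forall n x, shift_fun n (f x) = f (shift_fun (N *m n) x)) ->
  exists z : H, f = sym_homeo z /\ sdmx z.1.2 = M.
Proof.
move=> NM MN fN.
have [n [t [Nsgn tN t_const ft]]] := homeo_rigidity col0 act1
  actM act_trans col_onto col_delta col_step a0 NM MN fN.
pose Q : hyperoct d := Hyperoct Nsgn.
have QV : hyperoct_mx Q^-1%g = M.
  by rewrite -[LHS]mulmx1 -NM mulmxA hyperoct_mxVK mul1mx.
have tE k a : t (act k a) = act (col (M *m mark d k)) (t a).
  rewrite -tN; last first.
    rewrite -QV; apply: signed_perm_inbox (valP Q^-1%g) _.
    by apply: inbox_le (mark_inbox d_gt0 k); exact: leq_pred.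
  rewrite mulmxA NM mul1mx -[mark d k]mul1mx -[1%:M]/(hyperoct_mx 1%g).
  by rewrite column_mark.
(* If [Q] were not in [P], all columns at [M *m mark d k] would be trivial, so [t] would be constant
   by transitivity. *)
have QP : Q \in P.
  rewrite -groupV; apply: contrapT => QnP.
  have cM (k : K) : col (M *m mark d k) = 1%g.
    apply/eqP; apply: contrapT => /negP; rewrite -QV => cMk.
    by apply: QnP; exact: column_markV cMk.
  have [k [a ka]] := act_nontriv.
  case/eqP: ka; apply: t_const => b c.
  have [l <-] := act_trans b c.
  by rewrite tE cM act1.
have tact k a : t (act k a) = act k (t a).
  rewrite tE; congr (act _ _); rewrite -QV.
  by rewrite column_mark // groupV.
have [g tg] := aut_full tact.
(* Read off from [f x p = t (x (N (p - n)))]. *)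
exists ((- n, (subg P Q)^-1%g) : lattice_sdprod P, g).
have qE : sdmx (subg P Q) = N by rewrite /sdmx subgK.
split; last first.
  by rewrite /= -[LHS]mulmx1 -NM -qE mulmxA sdmxVK mul1mx.
apply: selfhomeo_eq => x; apply/val_inj/funext => p.
by rewrite sym_funE /= invgK qE -tg -ft addrA subrr add0r.
Qed.

Lemma normaliser_sym_homeo (z : H) :
  Defs.normaliser (shift_group rho) (sym_homeo z).
Proof.
have conjE n : (shift_homeo rho n ^ sym_homeo z)%g =
    shift_homeo rho (sdmx (z.1.2)^-1%g *m n).
  apply: selfhomeo_eq => x; rewrite conjgE.
  by rewrite /= -[RHS](sym_funK z); congr (sym_fun _ _); exact: shift_sym_homeo.
apply/seteqP; split=> [_ [_ [n _ <-] <-]|_ [n _ <-]].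
  by rewrite conjE; exists (sdmx (z.1.2)^-1%g *m n).
exists (shift_homeo rho (sdmx z.1.2 *m n)); first by exists (sdmx z.1.2 *m n).
by rewrite conjE mulmxA sdmxVK mul1mx.
Qed.

Lemma extended_symmetry_group_iso :
  isomorphic_to (extended_symmetry_group rho) H.
Proof.
exists sym_homeo; split.
- by move=> z _; exact: normaliser_sym_homeo.
- by move=> z w _ _; exact: sym_homeo_inj.
move=> f fnorm.
have [N [M [NM MN fN]]] := normaliser_shift col0 act1
  actM act_trans col_onto col_delta col_step a0 fnorm.
by have [z [-> _]] := homeo_sym NM MN fN; exists z.
Qed.

Definition translation_homeo (z : GRing.to_multiplicative 'Zd_d * G) :
  selfhomeo X := sym_homeo ((z.1, 1%g) : lattice_sdprod P, z.2).

Lemma translation_homeoM : {morph translation_homeo : z w / (z * w)%g}.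
Proof.
move=> z w; rewrite /translation_homeo -sym_homeoM; congr sym_homeo.
congr ((_, _), _); last by rewrite mulg1.
by rewrite /= sdmx1 mul1mx.
Qed.

HB.instance Definition _ := isMultiplicative.Build
  (GRing.to_multiplicative 'Zd_d * G)%type (selfhomeo X)
  translation_homeo translation_homeoM.

(** Commuting with the shifts is the case [N = 1] of [homeo_sym]. *)
Lemma symmetry_group_iso : isomorphic_to (symmetry_group rho)
  (GRing.to_multiplicative 'Zd_d * G)%type.
Proof.
exists translation_homeo; split.
- move=> z _ _ [n _ <-]; apply: selfhomeo_eq => x /=.
  rewrite -[RHS]/(shift_fun n (translation_homeo z x)) shift_sym_homeo /=.
  by rewrite invg1 sdmx1 mul1mx.
- by move=> [n g] [m k] _ _ /= /sym_homeo_inj[-> ->].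
move=> f fC.
have fN n x : shift_fun n (f x) = f (shift_fun (1%:M *m n) x).
  rewrite mul1mx.
  have : commute f (shift_homeo rho n) by apply: fC; exists n.
  by move/(congr1 (fun g : selfhomeo X => g x)).
have [[[n q] g] [-> /= q1]] := homeo_sym (mul1mx _) (mul1mx _) fN.
exists (n, g) => //=; rewrite /translation_homeo /=.
by congr (sym_homeo ((_, _), _)); apply: sdmx_inj; rewrite q1.
Qed.

End Realisation.

Theorem theorem35 (d : nat) (d_ge1 : (1 <= d)%N) (G : finGroupType)
    (P : {group hyperoct d}) :
  exists (A : finType) (rho : rect_subst d A),
    [/\ aperiodic_subst rho, primitive_subst rho, bijective_subst rho,
        isomorphic_to (symmetry_group rho)
          (GRing.to_multiplicative 'Zd_d * G)%type
      & isomorphic_to (extended_symmetry_group rho)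
          (lattice_sdprod P * G)%type].
Proof.
exists (G * 'I_3)%type, (marked_subst P (@letter_act G)).
pose a0 : G * 'I_3 := (1%g, ord0); split.
- exact: (marked_subst_aperiodic d_ge1 (@letter_act1 G) (@letter_actM G)
    (@letter_act_trans G) (letter_act_nontriv G)).
- exact: (marked_subst_primitive P d_ge1 (@letter_act1 G) (@letter_actM G)
    (@letter_act_trans G)).
- exact: (marked_subst_bijective (@letter_act1 G) (@letter_actM G)).
- exact: (symmetry_group_iso P a0 d_ge1 (@letter_act1 G) (@letter_actM G)
    (@letter_act_trans G) (letter_act_nontriv G) (@letter_mul1 G)
    (@letter_mulM G) (@letter_mulC G) (@letter_mul_free G)
    (@letter_centraliser G)).
- exact: (extended_symmetry_group_iso P a0 d_ge1 (@letter_act1 G)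
    (@letter_actM G) (@letter_act_trans G) (letter_act_nontriv G)
    (@letter_mul1 G) (@letter_mulM G) (@letter_mulC G) (@letter_mul_free G)
    (@letter_centraliser G)).
Qed.
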